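(* Let $s>1$ and let $\mathbf{k}=(k_j)_{j\in\mathbb{N}}$ be a strictly increasing sequence in $\mathbb{N}$. Set $\lfloor\mathbf{k}^s\rfloor:=(\lfloor k_j^s\rfloor)_{j\in\mathbb{N}}$. Then for every Markoff measure $\mu\in\mathrm{Mar}(\mathbb{T})$, the space $E\big(\Lambda(\mathbf{k},\lfloor\mathbf{k}^s\rfloor)\big)$ is dense in $L^2(\mathbb{T},\mu)$. In particular, there exists a subset $\Lambda\subseteq\mathbb{N}$ with lower density $\underline{\mathrm{d}}(\Lambda)=0$ such that $E(\Lambda)$ is dense in $L^2(\mathbb{T},\mu)$ for every $\mu\in\mathrm{Mar}(\mathbb{T})$.
   Context: Conventions: $\mathbb{N}=\{1,2,3,\dots\}$, $\mathbb{N}_0=\mathbb{N}\cup\{0\}$, $\mathbb{T}$ is the complex unit circle, $\mathbb{D}$ is the open unit disk, and $\llbracket n,m\rrbracket:=[n,m]\cap\mathbb{Z}$ for integers $n\le m$. For $\Lambda\subseteq\mathbb{N}_0$, $E(\Lambda)$ is the complex linear span of the functions $z\mapsto z^\lambda$ on $\mathbb{T}$, $\lambda\in\Lambda$. For a strictly increasing sequence $\mathbf{k}=(k_j)_j\in\mathbb{N}^{\mathbb{N}}$ and $\bm{\ell}=(\ell_j)_j\in\mathbb{N}_0^{\mathbb{N}}$, set $\Lambda(\mathbf{k},\bm{\ell}):=\bigcup_{j\in\mathbb{N}}\llbracket k_j,k_j+\ell_j\rrbracket$ (the intervals need not be disjoint). The lower density of $\Lambda\subseteq\mathbb{N}$ is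 $\underline{\mathrm{d}}(\Lambda):=\liminf_{N\to\infty}\frac{|\Lambda\cap\llbracket 1,N\rrbracket|}{N}$. $\mathcal{P}$ is the set of all probability measures on $\mathbb{T}$ with infinite support. For $\mu\in\mathcal{P}$ and $n\in\mathbb{N}_0$, let $\Phi_n$ be the monic orthogonal polynomial of degree $n$, i.e. the unique monic polynomial of degree $n$ that is orthogonal in $L^2(\mathbb{T},\mu)$ to all polynomials of degree less than $n$. Let $\Phi_n^*(z):=z^n\overline{\Phi_n(z)}$ for $z\in\mathbb{T}$ (a polynomial of degree at most $n$). The Verblunsky coefficients $\alpha_n=\alpha_n(\mu)\in\mathbb{D}$, $n\in\mathbb{N}_0$, are the numbers determined by the Szegő recurrence $\Phi_{n+1}(z)=z\Phi_n(z)-\overline{\alpha_n}\,\Phi_n^*(z)$. For $\ell\in\mathbb{N}_0$ and $\varepsilon\in(0,1)$, $\mathrm{Mar}_{\varepsilon,\ell}(\mathbb{T})$ is the set of all $\mu\in\mathcal{P}$ with $\inf_{n\in\mathbb{N}_0}\max_{n\le j\le n+\ell}|\alpha_j(\mu)|\ge\varepsilon$. The class of Markoff measures is $\mathrm{Mar}(\mathbb{T}):=\bigcup_{\ell\in\mathbb{N}_0}\bigcup_{\varepsilon\in(0,1)}\mathrm{Mar}_{\varepsilon,\ell}(\mathbb{T})$. *)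

(* Defs.v *)
From HB Require Import structures.
From mathcomp Require Import all_boot all_order all_algebra.
From mathcomp Require Import complex.
From mathcomp Require Import all_classical all_reals all_analysis.

Set Implicit Arguments.
Unset Strict Implicit.
Unset Printing Implicit Defensive.

Import Order.TTheory GRing.Theory Num.Theory.
Import numFieldNormedType.Exports.

Local Open Scope classical_set_scope.
Local Open Scope ring_scope.

(* The modulus as an element of [R]; on [R[i]], [`|z|] itself lives in [R[i]]. *)
Notation cabs := ComplexField.Normc.normc.

(* [R[i]^o] is [R[i]] with the topology of its norm. *)
Definition unit_circle (R : realType) : set R[i]^o := [set z | `|z| = 1].
Arguments unit_circle : clear implicits.

Definition circle (R : realType) : Type := set_type (unit_circle R).

Lemma unit_circle1 (R : realType) : (1 : R[i]^o) \in unit_circle R.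
Proof. by rewrite inE /unit_circle /= normr1. Qed.

HB.instance Definition _ (R : realType) :=
  Topological.copy (circle R) (set_type (unit_circle R)).
HB.instance Definition _ (R : realType) :=
  isPointed.Build (circle R) (exist _ (1 : R[i]^o) (@unit_circle1 R)).

Definition cval (R : realType) (z : circle R) : R[i] := set_val z.

Definition circleB (R : realType) :=
  g_sigma_algebraType (@open (circle R)).

(* [circleB R] is convertible to [circle R], with the Borel sigma-algebra as
   its measurable sets. *)
Definition pt (R : realType) (z : circleB R) : R[i] := cval z.

Section measures_on_the_circle.
Context {R : realType}.
Implicit Types (mu : probability (circleB R) R) (f g : circleB R -> R[i]).

Definition msupport mu : set (circle R) :=
  [set z | forall U : set (circle R), open U -> U z -> (0 < mu U)%E].

Definition infinitely_supported mu : Prop := infinite_set (msupport mu).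

Definition cmeasurable f : Prop :=
  measurable_fun [set: circleB R] (fun z => complex.Re (f z)) /\
  measurable_fun [set: circleB R] (fun z => complex.Im (f z)).

Definition cintegral mu f : R[i] :=
  Complex (Rintegral mu setT (fun z => complex.Re (f z)))
          (Rintegral mu setT (fun z => complex.Im (f z))).

Definition L2norm mu f : \bar R := Lnorm mu 2%:E (fun z => (cabs (f z))%:E).

Definition L2 mu : set (circleB R -> R[i]) :=
  [set f | cmeasurable f /\ (L2norm mu f < +oo)%E].

Definition L2dot mu f g : R[i] := cintegral mu (fun z => f z * conjc (g z)).

Definition L2dense mu (E : set (circleB R -> R[i])) : Prop :=
  E `<=` L2 mu /\
  forall f, L2 mu f -> forall e : R, 0 < e ->
    exists2 g, E g & (L2norm mu (fun z => (f z - g z)%R) < e%:E)%E.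

Definition polyfun (p : {poly R[i]}) : circleB R -> R[i] := fun z => p.[pt z].

Definition is_monic_orthogonal mu (n : nat) (p : {poly R[i]}) : Prop :=
  [/\ p \is monic, size p = n.+1 &
      forall q : {poly R[i]}, (size q <= n)%N ->
        L2dot mu (polyfun p) (polyfun q) = 0].

(* For an infinitely supported [mu] there is exactly one such polynomial, which
   [xget] selects; the default value [0] is then irrelevant. *)
Definition Phi mu (n : nat) : {poly R[i]} := xget 0 (is_monic_orthogonal mu n).

Definition Phistar mu (n : nat) : circleB R -> R[i] :=
  fun z => pt z ^+ n * conjc (Phi mu n).[pt z].

Definition szego_recurrence mu (n : nat) (a : R[i]) : Prop :=
  forall z : circleB R,
    (Phi mu n.+1).[pt z] = pt z * (Phi mu n).[pt z] - conjc a * Phistar mu n z.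

(* Likewise, for an infinitely supported [mu] exactly one [a] satisfies the
   Szego recurrence at rank [n]. *)
Definition verblunsky mu (n : nat) : R[i] := xget 0 (szego_recurrence mu n).

(* All moduli are nonnegative, so [0] is neutral for the maximum, and the
   infimum is over a nonempty set bounded below. *)
Definition Mar_class (eps : R) (l : nat) mu : Prop :=
  infinitely_supported mu /\
  eps <= inf [set \big[Num.max/0]_(n <= j < (n + l).+1) cabs (verblunsky mu j)
             | n in [set: nat]].

Definition Markoff mu : Prop :=
  exists (l : nat) (eps : R), 0 < eps < 1 /\ Mar_class eps l mu.

Definition Espan (L : set nat) : set (circleB R -> R[i]) :=
  [set f | exists (s : seq nat) (c : nat -> R[i]),
     {in s, forall l, L l} /\ f = fun z => \sum_(l <- s) c l * pt z ^+ l].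

End measures_on_the_circle.

(* Sequences indexed by the positive integers are here indexed from [0]. *)
Definition Lambda (k l : nat -> nat) : set nat :=
  [set n | exists j, (k j <= n <= k j + l j)%N].

(* The term [N = 0] is [0 / 0 = 0] and does not affect the lower limit. *)
Definition lower_density (R : realType) (L : set nat) : \bar R :=
  limn_einf (fun N : nat =>
    ((\sum_(1 <= n < N.+1) (n \in L))%:R / N%:R : R)%:E).

(* Main.v *)
(* A monomial conj z ^ a z ^ i is approximated by polynomials with exponents in
   a long block [k, k + n) as follows.  The reversed orthogonal polynomial
   B = Phi_n^* satisfies B(0) = 1, and
   ||B||^2 = prod_(j < n) (1 - |alpha_j|^2) is exponentially small in n for a Markoff
   measure.  The Szego recurrence bounds the i-th coefficient of B by 'C(n, i);
   so the Taylor polynomial P of 1 / B of degree < K is at most (2 n)^K on the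
   circle, and P B = 1 + z^K Q with deg Q < n.  Thus 1 is approximated by -z^K Q
   with squared error (2 n)^(2 K) exp(- c n), which is small as soon as n >= k^s
   with s > 1.  Hence all trigonometric polynomials lie in the closure of
   E(Lambda), and they are dense in L^2: the indicator of a half-plane is a
   bounded pointwise limit of polynomials in a cosine, intersections of
   half-planes generate the Borel sets, and the pi-lambda theorem applies. *)
Require Import Defs.
From HB Require Import structures.
From mathcomp Require Import all_boot all_order all_algebra.
From mathcomp Require Import complex ring lra zify finmap.
From mathcomp Require Import all_classical all_reals all_analysis.
From mathcomp Require Import measurable_realfun.

Set Implicit Arguments.
Unset Strict Implicit.
Unset Printing Implicit Defensive.

Import Order.TTheory GRing.Theory Num.Theory.
Import numFieldNormedType.Exports.

Local Open Scope classical_set_scope.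
Local Open Scope ring_scope.

(** * The circle *)

Section squared_modulus.
Context {R : realType}.
Implicit Types x y z : R[i].

(** No lower bound on |B| over the circle is at hand, so 1 / B cannot be estimated there directly;
    coefficient bounds are available, and they cost the factor (2 n)^K. When n is about k^s, its
    logarithm K log n is of order k log k, while the squared norm of B decays like exp(- c k^s):
    this comparison is where s > 1 enters. Negative frequencies come at almost no cost: conj z ^ a z
    ^ i has modulus one on the circle, so multiplying the error P B by it preserves norms and only
    changes the order of the Taylor polynomial from k to k + a - i. Each tolerance calls for a
    single block, so what the argument asks of the set of exponents is that it contain long blocks
    arbitrarily far out. Blocks for s = 2, spaced very far apart, then give lower density zero.
    Estimates are made on squared norms: the inequalities between moduli stay polynomial, and
    [L2norm] appears only at the two ends. *)

Definition sqn z : R := complex.Re z ^+ 2 + complex.Im z ^+ 2.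

Lemma sqn_ge0 z : 0 <= sqn z.
Proof. by rewrite addr_ge0 // sqr_ge0. Qed.

Lemma sqrt_sqn z : Num.sqrt (sqn z) = cabs z.
Proof. by case: z. Qed.

Lemma sqn_cabs z : sqn z = cabs z ^+ 2.
Proof. by rewrite -sqrt_sqn sqr_sqrtr // sqn_ge0. Qed.

Lemma cabs_ge0 z : 0 <= cabs z.
Proof. by rewrite -sqrt_sqn sqrtr_ge0. Qed.

Lemma sqnM x y : sqn (x * y) = sqn x * sqn y.
Proof. by case: x => a b; case: y => c d; rewrite /sqn /=; ring. Qed.

Lemma sqnX x n : sqn (x ^+ n) = sqn x ^+ n.
Proof.
elim: n => [|n IH]; last by rewrite !exprS sqnM IH.
by rewrite !expr0 /sqn /=; ring.
Qed.

Lemma sqnJ x : sqn (conjc x) = sqn x.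
Proof. by case: x => a b; rewrite /sqn /= sqrrN. Qed.

Lemma conjcM x y : conjc (x * y) = conjc x * conjc y.
Proof. exact: rmorphM. Qed.

Lemma conjcD x y : conjc (x + y) = conjc x + conjc y.
Proof. exact: rmorphD. Qed.

Lemma sqnN x : sqn (- x) = sqn x.
Proof. by case: x => a b; rewrite /sqn /= !sqrrN. Qed.

(** The parallelogram law: the difference of the two sides is |x - y|^2. It plays the part of the
    triangle inequality for squared norms. *)
Lemma sqnD_le x y : sqn (x + y) <= 2 * (sqn x + sqn y).
Proof.
case: x => a b; case: y => c d; rewrite /sqn /=.
have := sqr_ge0 (a - c); have := sqr_ge0 (b - d); nra.
Qed.

Lemma cabs1 : cabs (1 : R[i]) = 1.
Proof. exact: ComplexField.Normc.normc1. Qed.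

Lemma cabs0 : cabs (0 : R[i]) = 0.
Proof. exact: ComplexField.Normc.normc0. Qed.

Lemma cabsM x y : cabs (x * y) = cabs x * cabs y.
Proof. exact: ComplexField.Normc.normcM. Qed.

Lemma cabsN x : cabs (- x) = cabs x.
Proof. by rewrite -!sqrt_sqn sqnN. Qed.

Lemma cabsD_le x y : cabs (x + y) <= cabs x + cabs y.
Proof. exact: complex.le_normcD. Qed.

Lemma sqn_real (a : R) : sqn (Complex a 0) = a ^+ 2.
Proof. by rewrite /sqn /=; ring. Qed.

Lemma Re_sqn x : complex.Re (x * conjc x) = sqn x.
Proof. by case: x => a b; rewrite /sqn /=; ring. Qed.

Lemma Im_mulJ x : complex.Im (x * conjc x) = 0.
Proof. by case: x => a b /=; ring. Qed.

Lemma sqn_eq0 x : sqn x = 0 -> x = 0.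
Proof. by rewrite sqn_cabs => /eqP; rewrite sqrf_eq0 => /eqP /ComplexField.Normc.eq0_normc. Qed.

Lemma Re_le_cabs x : `|complex.Re x| <= cabs x.
Proof. by rewrite -sqrt_sqn -sqrtr_sqr ler_wsqrtr // lerDl sqr_ge0. Qed.

Lemma Im_le_cabs x : `|complex.Im x| <= cabs x.
Proof. by rewrite -sqrt_sqn -sqrtr_sqr ler_wsqrtr // lerDr sqr_ge0. Qed.

Lemma cabs_le_ReIm x : cabs x <= `|complex.Re x| + `|complex.Im x|.
Proof.
rewrite -sqrt_sqn -[leRHS]ger0_norm ?addr_ge0 // -sqrtr_sqr ler_wsqrtr //.
rewrite /sqn -(real_normK (num_real (complex.Re x))) -(real_normK (num_real (complex.Im x))).
by have := normr_ge0 (complex.Re x); have := normr_ge0 (complex.Im x); nra.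
Qed.

Lemma normC_cabs x : `|x| = Complex (cabs x) 0.
Proof. by case: x. Qed.

End squared_modulus.

Section circle_topology.
Context {R : realType}.

Lemma sqn_pt (z : circleB R) : sqn (pt z) = 1.
Proof.
rewrite sqn_cabs; have : `|pt z| = 1 by have := set_valP z.
by rewrite normC_cabs => -[->]; rewrite expr1n.
Qed.

Lemma pt_mulJ (z : circleB R) : pt z * conjc (pt z) = 1.
Proof.
have := sqn_pt z; rewrite -Re_sqn; have := Im_mulJ (pt z).
by case: (pt z * _) => a b /= -> ->.
Qed.

Lemma continuous_Re_cval : continuous (fun z : circle R => complex.Re (cval z) : R).
Proof.
move=> z; rewrite /cval; apply: (@continuous_comp _ _ _ set_val (fun x : R[i]^o => complex.Re x)).
  exact: initial_continuous.
move=> A /nbhs_ballP[e /= e0 eA].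
(* The norm of [R[i]^o] takes values in [R[i]], so the radius of a ball is a complex number and the
   real radius has to be embedded. *)
have e0' : 0 < Complex e 0 by rewrite ltcE /= eqxx.
apply/nbhs_ballP; exists (Complex e 0) => //= t; rewrite -ball_normE /=.
rewrite normC_cabs ltcE /= eqxx /= => /(le_lt_trans (Re_le_cabs _)) h.
by apply: eA; move: h; rewrite -ball_normE /=; case: (set_val z) (t) => a b [].
Qed.

Lemma continuous_Im_cval : continuous (fun z : circle R => complex.Im (cval z) : R).
Proof.
move=> z; rewrite /cval; apply: (@continuous_comp _ _ _ set_val (fun x : R[i]^o => complex.Im x)).
  exact: initial_continuous.
move=> A /nbhs_ballP[e /= e0 eA].
have e0' : 0 < Complex e 0 by rewrite ltcE /= eqxx.
apply/nbhs_ballP; exists (Complex e 0) => //= t; rewrite -ball_normE /=.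
rewrite normC_cabs ltcE /= eqxx /= => /(le_lt_trans (Im_le_cabs _)) h.
by apply: eA; move: h; rewrite -ball_normE /=; case: (set_val z) (t) => a b [].
Qed.

(** Both parts go through one induction, because a Horner step mixes the real and the imaginary
    part. *)
Lemma continuous_horner (T : topologicalType) (u v : T -> R) (p : {poly R[i]}) :
  continuous u -> continuous v ->
  continuous (fun z => complex.Re p.[Complex (u z) (v z)] : R) /\
  continuous (fun z => complex.Im p.[Complex (u z) (v z)] : R).
Proof.
move=> cu cv; elim/poly_ind: p => [|p c [IHr IHi]].
  by split=> z; under eq_fun do rewrite horner0; exact: cvg_cst.
split.
- have -> : (fun z => complex.Re (p * 'X + c%:P).[Complex (u z) (v z)]) =
    (fun z => complex.Re p.[Complex (u z) (v z)] * u z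
     - complex.Im p.[Complex (u z) (v z)] * v z + complex.Re c).
    by apply/funext => z; rewrite hornerMXaddC; case: (p.[_]); case: (c).
  move=> z; apply: cvgD; last exact: cvg_cst.
  by apply: cvgB; apply: cvgM; [exact: IHr|exact: cu|exact: IHi|exact: cv].
- have -> : (fun z => complex.Im (p * 'X + c%:P).[Complex (u z) (v z)]) =
    (fun z => complex.Re p.[Complex (u z) (v z)] * v z
     + complex.Im p.[Complex (u z) (v z)] * u z + complex.Im c).
    by apply/funext => z; rewrite hornerMXaddC; case: (p.[_]); case: (c).
  move=> z; apply: cvgD; last exact: cvg_cst.
  by apply: cvgD; apply: cvgM; [exact: IHr|exact: cv|exact: IHi|exact: cu].
Qed.

Lemma continuous_poly_cval (p : {poly R[i]}) :
  continuous (fun z : circle R => complex.Re p.[cval z] : R) /\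
  continuous (fun z : circle R => complex.Im p.[cval z] : R).
Proof.
have [hr hi] := continuous_horner p continuous_Re_cval continuous_Im_cval.
have E z : Complex (complex.Re (cval z)) (complex.Im (cval z)) = cval z.
  by case: (cval z).
by split=> z; [have := hr z|have := hi z]; rewrite /continuous_at;
  under eq_fun do rewrite E; rewrite E.
Qed.

Lemma continuous_measurable_circle (h : circle R -> R) : continuous h ->
  measurable_fun [set: circleB R] (h : circleB R -> R).
Proof.
move=> /continuousP ch; apply: (measurability _ (RGenOpens.measurableE R)).
move=> _ [_ [a [b ->] <-]]; rewrite setTI.
by apply: sub_sigma_algebra; apply: ch; exact: interval_open.
Qed.

(** Squares serve better than discs here: a square is an intersection of four half-planes, and
    half-planes are the sets whose indicators get approximated. *)
Lemma open_circle_square (U : set (circle R)) (z : circle R) : open U -> U z ->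
  exists2 d : R, 0 < d & forall w : circle R,
    `|complex.Re (cval w) - complex.Re (cval z)| < d ->
    `|complex.Im (cval w) - complex.Im (cval z)| < d -> U w.
Proof.
move=> [V oV <-] /= Vz.
have /nbhs_ballP[e /= e0 eV] : nbhs (set_val z : R[i]^o) V by exact: open_nbhs_nbhs.
case: e e0 eV => e e'; rewrite ltcE /= => /andP[/eqP -> e0] eV.
exists (e / 2); first by rewrite divr_gt0.
move=> w hr hi; apply: eV; rewrite -ball_normE /= normC_cabs ltcE /= eqxx /=.
apply: le_lt_trans (cabs_le_ReIm _) _.
move: hr hi; rewrite /cval; case: (set_val w) => a b; case: (set_val z) => c d /=.
rewrite (distrC a) (distrC b); lra.
Qed.

End circle_topology.

(** * Mean-square integrals *)

Section measurability_and_integrals.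
Context {R : realType}.
Implicit Types (f g : circleB R -> R[i]) (mu : probability (circleB R) R).

Lemma cmeasurable_cst (c : R[i]) : cmeasurable (fun _ : circleB R => c).
Proof. by split; exact: measurable_cst. Qed.

Lemma cmeasurableD f g :
  cmeasurable f -> cmeasurable g -> cmeasurable (fun z => f z + g z).
Proof.
move=> [fr fi] [gr gi]; split.
- have -> : (fun z => complex.Re (f z + g z)) =
    (fun z => complex.Re (f z) + complex.Re (g z)).
    by apply/funext => z; case: (f z) (g z) => ? ? [].
  exact: measurable_funD.
- have -> : (fun z => complex.Im (f z + g z)) =
    (fun z => complex.Im (f z) + complex.Im (g z)).
    by apply/funext => z; case: (f z) (g z) => ? ? [].
  exact: measurable_funD.
Qed.

Lemma cmeasurableM f g :
  cmeasurable f -> cmeasurable g -> cmeasurable (fun z => f z * g z).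
Proof.
move=> [fr fi] [gr gi]; split.
- have -> : (fun z => complex.Re (f z * g z)) =
    (fun z => complex.Re (f z) * complex.Re (g z) - complex.Im (f z) * complex.Im (g z)).
    by apply/funext => z; case: (f z) (g z) => ? ? [].
  by apply: measurable_funB; exact: measurable_funM.
- have -> : (fun z => complex.Im (f z * g z)) =
    (fun z => complex.Re (f z) * complex.Im (g z) + complex.Im (f z) * complex.Re (g z)).
    by apply/funext => z; case: (f z) (g z) => ? ? [].
  by apply: measurable_funD; exact: measurable_funM.
Qed.

Lemma cmeasurableZ (c : R[i]) f : cmeasurable f -> cmeasurable (fun z => c * f z).
Proof. by apply: cmeasurableM; exact: cmeasurable_cst. Qed.

Lemma cmeasurableB f g :
  cmeasurable f -> cmeasurable g -> cmeasurable (fun z => f z - g z).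
Proof.
move=> mf mg; have := cmeasurableD mf (cmeasurableZ (-1) mg).
by under [X in cmeasurable X]eq_fun do rewrite mulN1r.
Qed.

Lemma cmeasurableJ f : cmeasurable f -> cmeasurable (fun z => conjc (f z)).
Proof.
move=> [fr fi]; split.
  by have -> : (fun z => complex.Re (conjc (f z))) = (fun z => complex.Re (f z))
    by apply/funext => z; case: (f z).
have -> : (fun z => complex.Im (conjc (f z))) = \- (fun z => complex.Im (f z)).
  by apply/funext => z /=; case: (f z).
exact: measurable_funN.
Qed.

Lemma cmeasurable_polyfun (p : {poly R[i]}) : cmeasurable (polyfun p).
Proof.
by have [? ?] := continuous_poly_cval p; split; exact: continuous_measurable_circle.
Qed.

Lemma cmeasurable_real (h : circleB R -> R) :
  measurable_fun setT h -> cmeasurable (fun z => Complex (h z) 0).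
Proof. by split=> //=; exact: measurable_cst. Qed.

Lemma measurable_sqn f : cmeasurable f -> measurable_fun setT (fun z => sqn (f z)).
Proof. by move=> [fr fi]; apply: measurable_funD; exact: measurable_funX. Qed.

Lemma bounded_integrable mu (h : circleB R -> R) (C : R) :
  measurable_fun setT h -> (forall z, `|h z| <= C) ->
  mu.-integrable setT (EFin \o h).
Proof.
move=> mh hC; apply: measurable_bounded_integrable => //.
  by apply: (@le_lt_trans _ _ 1%E); [exact: probability_le1|exact: ltry].
exists C; split; first exact: num_real.
by move=> M CM z _ /=; rewrite (le_trans (hC z)) ?ltW.
Qed.

(** The squared norm stays in the extended reals, so that it is meaningful before any integrability
    is established. *)
Definition N2 mu f : \bar R := (\int[mu]_z (sqn (f z))%:E)%E.

Lemma N2_ge0 mu f : (0 <= N2 mu f)%E.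
Proof. by apply: integral_ge0 => z _; rewrite lee_fin sqn_ge0. Qed.

Lemma le_N2 mu f g : cmeasurable f -> cmeasurable g ->
  (forall z, sqn (f z) <= sqn (g z)) -> (N2 mu f <= N2 mu g)%E.
Proof.
move=> mf mg fg; apply: ge0_le_integral => //; try by move=> z _; rewrite lee_fin ?sqn_ge0.
  by apply/measurable_EFinP; exact: measurable_sqn.
by apply/measurable_EFinP; exact: measurable_sqn.
Qed.

Lemma N2Z mu (c : R[i]) f : cmeasurable f ->
  N2 mu (fun z => c * f z) = ((sqn c)%:E * N2 mu f)%E.
Proof.
move=> mf; rewrite /N2; under eq_integral do rewrite sqnM EFinM.
rewrite ge0_integralZl_EFin ?sqn_ge0 //; first by move=> z _; rewrite lee_fin sqn_ge0.
by apply/measurable_EFinP; exact: measurable_sqn.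
Qed.

Lemma N2D_le mu f g : cmeasurable f -> cmeasurable g ->
  (N2 mu (fun z => f z + g z)%R <= 2%:E * (N2 mu f + N2 mu g))%E.
Proof.
move=> mf mg; have msf := measurable_sqn mf; have msg := measurable_sqn mg.
rewrite /N2 -ge0_integralD //; try (by move=> z _; rewrite lee_fin sqn_ge0);
  try exact/measurable_EFinP.
rewrite -ge0_integralZl_EFin //; first last.
- by apply: emeasurable_funD; exact/measurable_EFinP.
- by move=> z _; rewrite -EFinD lee_fin addr_ge0 ?sqn_ge0.
apply: ge0_le_integral => //; first by move=> z _; rewrite lee_fin sqn_ge0.
- by apply/measurable_EFinP; apply: measurable_sqn; exact: cmeasurableD.
- by apply: measurable_funeM; apply: emeasurable_funD; exact/measurable_EFinP.
- by move=> z _; rewrite -EFinD -EFinM lee_fin sqnD_le.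
Qed.

Lemma N2_bounded mu f (C : R) : cmeasurable f -> (forall z, sqn (f z) <= C) ->
  (N2 mu f <= C%:E)%E.
Proof.
move=> mf fC; rewrite -[leRHS]mule1 -(@probability_setT _ _ _ mu) -integral_cst //.
apply: ge0_le_integral => //; try by move=> z _; rewrite lee_fin ?sqn_ge0 ?(le_trans (sqn_ge0 _) (fC z)).
by apply/measurable_EFinP; exact: measurable_sqn.
Qed.

Lemma L2norm_lt mu f (e : R) : 0 < e ->
  ((L2norm mu f < e%:E) = (N2 mu f < (e ^+ 2)%:E))%E.
Proof.
move=> e0.
have -> : N2 mu f = (L2norm mu f `^ 2)%E.
  rewrite /L2norm powR_Lnorm // /N2; apply: eq_integral => z _ /=.
  by rewrite sqn_cabs ger0_norm ?cabs_ge0 // powR_mulrn ?cabs_ge0.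
rewrite -[in RHS]powR_mulrn ?(ltW e0) // -poweR_EFin.
have : (0 <= L2norm mu f)%E by exact: Lnorm_ge0.
case: (L2norm mu f) => [r||] //; last first.
  by move=> _; rewrite /= pnatr_eq0 /= !ltNge !leey.
rewrite lee_fin => r0; rewrite !poweR_EFin !lte_fin.
by rewrite !powR_mulrn ?(ltW e0) // ltr_pXn2r // ?nnegrE // ltW.
Qed.

Lemma L2normy mu f : (L2norm mu f < +oo)%E -> (N2 mu f < +oo)%E.
Proof.
move=> fy; have [r r0] : exists2 r : R, 0 < r & (L2norm mu f < r%:E)%E.
  move: fy; have : (0 <= L2norm mu f)%E by exact: Lnorm_ge0.
  case: (L2norm mu f) => [r||] // r0 _; exists (r + 1); last by rewrite lte_fin ltrDl.
  by rewrite ltr_wpDl.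
by rewrite L2norm_lt // => /lt_trans; apply; rewrite ltry.
Qed.

Lemma L2_bounded mu f (C : R) : cmeasurable f -> (forall z, sqn (f z) <= C) -> L2 mu f.
Proof.
move=> mf fC; split => //; apply: (@lt_trans _ _ (`|C| + 1)%:E); last by rewrite ltry.
rewrite L2norm_lt ?ltr_wpDl //; apply: le_lt_trans (N2_bounded mu mf fC) _.
rewrite lte_fin; have := ler_norm C; have := normr_ge0 C; nra.
Qed.

Lemma N2_dominated_cvg mu (f_ : nat -> circleB R -> R[i]) (G : circleB R -> R) :
  (forall n, cmeasurable (f_ n)) -> mu.-integrable setT (EFin \o G) ->
  (forall n z, sqn (f_ n z) <= G z) ->
  (forall z, sqn (f_ n z) @[n --> \oo] --> (0 : R)) ->
  N2 mu (f_ n) @[n --> \oo] --> 0%E.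
Proof.
move=> mf iG fG f0; rewrite /N2 -(integral0 mu setT).
apply: (@dominated_cvg _ _ _ mu setT _ (fun n z => (sqn (f_ n z))%:E) (cst 0%E) (EFin \o G)) => //.
- by move=> n; apply/measurable_EFinP; exact: measurable_sqn.
- by move=> z _; apply: cvg_EFin; [exact: nearW|exact: f0].
- by move=> n z _; rewrite gee0_abs ?lee_fin ?sqn_ge0 ?fG.
Qed.

End measurability_and_integrals.

(** * Approximation in the mean *)

Section approximation_in_the_mean.
Context {R : realType}.
Implicit Types (f g : circleB R -> R[i]) (mu : probability (circleB R) R).

(** Membership in the mean-square closure of [E]; the tolerance bounds the squared error.
    Measurability is carried along because monotonicity of the integral asks for it. *)
Definition approximable mu (E : set (circleB R -> R[i])) f : Prop :=
  cmeasurable f /\ forall e : R, 0 < e ->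
    exists2 g, E g & (N2 mu (fun z => f z - g z)%R < e%:E)%E.

Variables (mu : probability (circleB R) R) (E : set (circleB R -> R[i])).
Hypotheses (E0 : E (fun=> 0)) (Em : E `<=` cmeasurable).
Hypothesis ED : forall f g, E f -> E g -> E (fun z => f z + g z).
Hypothesis EZ : forall c f, E f -> E (fun z => c * f z).

Local Notation appr := (approximable mu E).

Lemma approximable0 : appr (fun=> 0).
Proof.
split; first exact: cmeasurable_cst.
move=> e e0; exists (fun=> 0) => //.
apply: (@le_lt_trans _ _ 0%E); last by rewrite lte_fin.
apply: (N2_bounded _ (C := 0)); first exact: cmeasurable_cst.
by move=> z; rewrite subr0 /sqn /= expr0n addr0.
Qed.

(** A quarter each, because of the factor 2 in [N2D_le]. *)
Lemma N2D_lt f g (e : R) : cmeasurable f -> cmeasurable g ->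
  (N2 mu f < (e / 4)%:E)%E -> (N2 mu g < (e / 4)%:E)%E ->
  (N2 mu (fun z => f z + g z)%R < e%:E)%E.
Proof.
move=> mf mg fe ge; apply: le_lt_trans (N2D_le _ mf mg) _.
move: fe ge (N2_ge0 mu f) (N2_ge0 mu g).
case: (N2 mu f) => [a||]; case: (N2 mu g) => [b||] //.
rewrite !lte_fin => ae be _ _; lra.
Qed.

Lemma approximableD f g : appr f -> appr g -> appr (fun z => f z + g z).
Proof.
move=> [mf fE] [mg gE]; split; first exact: cmeasurableD.
move=> e e0; have e4 : 0 < e / 4 by rewrite divr_gt0.
have [f' Ef' ff'] := fE _ e4; have [g' Eg' gg'] := gE _ e4.
exists (fun z => f' z + g' z); first exact: ED.
have -> : (fun z => f z + g z - (f' z + g' z)) =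
  (fun z => (f z - f' z) + (g z - g' z)) by apply/funext => z; ring.
by apply: N2D_lt => //; apply: cmeasurableB => //; exact: Em.
Qed.

Lemma approximableZ c f : appr f -> appr (fun z => c * f z).
Proof.
move=> [mf fE]; split; first exact: cmeasurableZ.
(* The added 1 keeps the quotient defined when [c] is 0. *)
move=> e e0; have c1 : 0 < sqn c + 1 by rewrite ltr_wpDl // sqn_ge0.
have [f' Ef' ff'] := fE _ (divr_gt0 e0 c1).
exists (fun z => c * f' z); first exact: EZ.
have -> : (fun z => c * f z - c * f' z) = (fun z => c * (f z - f' z)).
  by apply/funext => z; ring.
rewrite N2Z; last by apply: cmeasurableB => //; exact: Em.
move: ff' (N2_ge0 mu (fun z => f z - f' z)).
case: (N2 _ _) => [a||] //; rewrite lte_fin lee_fin ltr_pdivlMr // => ae a0.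
rewrite lte_fin; have := sqn_ge0 c; nra.
Qed.

Lemma approximable_closed f : cmeasurable f ->
  (forall e : R, 0 < e -> exists2 g, appr g & (N2 mu (fun z => f z - g z)%R < e%:E)%E) ->
  appr f.
Proof.
move=> mf fa; split => // e e0; have e4 : 0 < e / 4 by rewrite divr_gt0.
have [g [mg gE] fg] := fa _ e4; have [h Eh gh] := gE _ e4; exists h => //.
have -> : (fun z => f z - h z) = (fun z => (f z - g z) + (g z - h z)).
  by apply/funext => z; ring.
by apply: N2D_lt => //; apply: cmeasurableB => //; exact: Em.
Qed.

Lemma approximable_sum I (r : seq I) (F : I -> circleB R -> R[i]) :
  (forall i, appr (F i)) -> appr (fun z => \sum_(i <- r) F i z).
Proof.
move=> aF; elim: r => [|i r IH].
  by under eq_fun do rewrite big_nil; exact: approximable0.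
by under eq_fun do rewrite big_cons; exact: approximableD.
Qed.

Lemma approximable_dominated_cvg (f_ : nat -> circleB R -> R[i]) f (G : circleB R -> R) :
  (forall n, appr (f_ n)) -> cmeasurable f -> mu.-integrable setT (EFin \o G) ->
  (forall n z, sqn (f z - f_ n z) <= G z) ->
  (forall z, sqn (f z - f_ n z) @[n --> \oo] --> (0 : R)) -> appr f.
Proof.
move=> fa mf iG fG f0; apply: approximable_closed => // e e0.
have /fine_cvgP[fin /cvgrPdist_lt/(_ _ e0)] :
    N2 mu (fun z => f z - f_ n z) @[n --> \oo] --> 0%E.
  apply: (@N2_dominated_cvg _ mu (fun n z => f z - f_ n z) G) => // n.
  by apply: cmeasurableB => //; exact: (fa n).1.
move=> near_e; have [n _ hn] : \forall n \near \oo,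
    (N2 mu (fun z => f z - f_ n z)%R < e%:E)%E.
  near=> n; have : N2 mu (fun z => f z - f_ n z) \is a fin_num by near: n.
  have : `|0 - fine (N2 mu (fun z => f z - f_ n z))| < e by near: n.
  case: (N2 _ _) (N2_ge0 mu (fun z => f z - f_ n z)) => [a||] //= a0.
  by rewrite sub0r normrN lte_fin ger0_norm.
by exists (f_ n); [exact: fa|apply: hn => /=].
Unshelve. all: by end_near. Qed.

End approximation_in_the_mean.

(** * Polynomial approximation of a step on [0, 1] *)

Section step_functions.
Context {R : realType}.

(** A companion of Bernoulli's inequality: it makes (1 - v)^N small as soon as N v is large. The
    induction rests on (1 - v)(1 + (N + 1) v) <= 1 + N v. *)
Lemma onemX_le (v : R) N : 0 <= v <= 1 -> (1 - v) ^+ N * (1 + N%:R * v) <= 1.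
Proof.
move=> /andP[v0 v1]; elim: N => [|N IH]; first by rewrite mul0r addr0 mulr1 expr0.
have h : 0 <= (1 - v) ^+ N by rewrite exprn_ge0 // subr_ge0.
apply: le_trans IH; rewrite exprSr -mulrA ler_wpM2l //.
rewrite -natr1; have : 0 <= N%:R :> R by []. nra.
Qed.

(** Bernoulli's inequality: (1 - v)^N is close to 1 when N v is small. *)
Lemma onemX_ge (v : R) N : 0 <= v <= 1 -> 1 - N%:R * v <= (1 - v) ^+ N.
Proof.
move=> /andP[v0 v1]; elim: N => [|N IH]; first by rewrite mul0r subr0 expr0.
rewrite exprSr -natr1; apply: le_trans (_ : (1 - N%:R * v) * (1 - v) <= _); last first.
  by rewrite ler_wpM2r // subr_ge0.
have : 0 <= N%:R :> R by []. nra.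
Qed.

(* With [y = sqrt x], [n y^n] is at most the geometric sum [1 / (1 - y)]. *)
Lemma cvg_nexpr (x : R) : 0 <= x < 1 -> n%:R * x ^+ n @[n --> \oo] --> (0 : R).
Proof.
move=> /andP[x0 x1]; pose y := Num.sqrt x.
have y0 : 0 <= y by exact: sqrtr_ge0.
have y2 : y ^+ 2 = x by rewrite sqr_sqrtr.
have y1 : y < 1 by rewrite -sqrtr1 ltr_sqrt.
apply: (@squeeze_cvgr _ _ _ _ (fun=> 0) (fun n => (1 - y)^-1 * y ^+ n)).
- apply: nearW => n; rewrite mulr_ge0 ?exprn_ge0 //= -y2 -exprM mulnC exprM expr2 mulrA.
  rewrite ler_wpM2r ?exprn_ge0 // -[leRHS]mul1r ler_pdivlMr ?subr_gt0 //.
  have := subrXX 1 y n; rewrite expr1n => h.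
  apply: le_trans (_ : 1 - y ^+ n <= _); last by rewrite lerBlDr lerDl exprn_ge0.
  rewrite h mulrC ler_wpM2l ?subr_ge0 ?(ltW y1) //.
  rewrite -[n in n%:R]card_ord -sum1_card natr_sum mulr_suml ler_sum // => i _.
  by rewrite expr1n mul1r mul1r ler_wiXn2l ?(ltW y1) // ltnW.
- exact: cvg_cst.
- rewrite -[X in _ --> X](mulr0 (1 - y)^-1); apply: cvgM; first exact: cvg_cst.
  by apply: cvg_expr; rewrite ger0_norm.
Qed.

(** Take N about n / r^n. Then N u^n is about n (u / r)^n, which tends to 0 for u < r and is at
    least n for u >= r; the two Bernoulli bounds turn this into the limits 1 and 0. The limit at the
    jump u = r is 0, so the strict inequality is recovered at every point. *)
Lemma step_approximation (r : R) : 0 < r <= 1 -> exists N : nat -> nat,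
  forall u : R, 0 <= u <= 1 ->
    (1 - u ^+ n) ^+ (N n) @[n --> \oo] --> ((u < r)%R%:R : R).
Proof.
move=> /andP[r0 r1]; exists (fun n => (Num.truncn (n%:R / r ^+ n)).+1) => u /andP[u0 u1].
have un01 n : 0 <= u ^+ n <= 1 by rewrite exprn_ge0 //= exprn_ile1.
have [ur|ru] := ltP u r.
- apply: (@squeeze_cvgr _ _ _ _ (fun n => 1 - (n%:R * (u / r) ^+ n + u ^+ n)) (fun=> 1)).
  + apply: nearW => n; apply/andP; split; last first.
      by have /andP[? ?] := un01 n; rewrite exprn_ile1 ?subr_ge0 // lerBlDr lerDl.
    apply: le_trans (onemX_ge _ (un01 n)); rewrite lerD2l lerN2 -natr1 mulrDl mul1r lerD2r.
    rewrite exprMn exprVn mulrCA [leRHS]mulrC ler_wpM2r ?exprn_ge0 //.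
    by rewrite truncn_le // divr_ge0 // exprn_ge0 // ltW.
  + rewrite -[X in _ --> X](subr0 1); apply: cvgB; first exact: cvg_cst.
    rewrite -[X in _ --> X](addr0 0); apply: cvgD.
      by apply: cvg_nexpr; rewrite divr_ge0 ?(ltW r0) //= ltr_pdivrMr // mul1r.
    by apply: cvg_expr; rewrite ger0_norm // (lt_le_trans ur).
  + exact: cvg_cst.
- apply: (@squeeze_cvgr _ _ _ _ (fun=> 0) (@harmonic R)).
  + apply: nearW => n; have /andP[? ?] := un01 n; rewrite exprn_ge0 ?subr_ge0 //=.
    rewrite -[leRHS]mul1r ler_pdivlMr ?ltr0n //.
    apply: le_trans (onemX_le (Num.truncn (n%:R / r ^+ n)).+1 (un01 n)).
    rewrite ler_wpM2l ?exprn_ge0 ?subr_ge0 // -natr1 addrC lerD2l.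
    apply: le_trans (_ : (n%:R / r ^+ n) * r ^+ n <= _).
      by rewrite divfK // expf_neq0 // gt_eqF.
    apply: ler_pM; rewrite ?divr_ge0 ?exprn_ge0 ?(ltW r0) //.
      by rewrite ltW // truncnS_gt.
    by rewrite lerXn2r ?nnegrE // ltW.
  + exact: cvg_cst.
  + exact: cvg_harmonic.
Qed.

End step_functions.

(** * Trigonometric polynomials *)

Section trigonometric_polynomials.
Context {R : realType}.
Implicit Types (f g : circleB R -> R[i]).

(** On the circle conj z is the inverse of z, so a Laurent polynomial is an ordinary polynomial
    times one power of conj z. *)
Definition trigpoly f : Prop := exists (a : nat) (p : {poly R[i]}),
  f = fun z => conjc (pt z) ^+ a * p.[pt z].

Lemma trigpoly_cst (c : R[i]) : trigpoly (fun=> c).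
Proof. by exists 0%N, c%:P; apply/funext => z; rewrite expr0 mul1r hornerC. Qed.

Lemma ptJ_mul (z : circleB R) n : conjc (pt z) ^+ n * pt z ^+ n = 1.
Proof. by rewrite -exprMn mulrC pt_mulJ expr1n. Qed.

Lemma trigpolyM f g : trigpoly f -> trigpoly g -> trigpoly (fun z => f z * g z).
Proof.
move=> [a [p ->]] [b [q ->]]; exists (a + b)%N, (p * q); apply/funext => z.
by rewrite hornerM exprD; ring.
Qed.

Lemma trigpolyD f g : trigpoly f -> trigpoly g -> trigpoly (fun z => f z + g z).
Proof.
move=> [a [p ->]] [b [q ->]]; exists (a + b)%N, ('X^b * p + 'X^a * q).
apply/funext => z; rewrite hornerD !hornerM !hornerXn exprD.
have -> (x y u v : R[i]) : x * y * (u * p.[pt z] + v * q.[pt z]) =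
  (y * u) * (x * p.[pt z]) + (x * v) * (y * q.[pt z]) by ring.
by rewrite !ptJ_mul !mul1r.
Qed.

Lemma trigpolyX f n : trigpoly f -> trigpoly (fun z => f z ^+ n).
Proof.
move=> tf; elim: n => [|n IH].
  by under eq_fun do rewrite expr0; exact: trigpoly_cst.
by under eq_fun do rewrite exprS; exact: trigpolyM.
Qed.

Lemma cmeasurable_trigpoly f : trigpoly f -> cmeasurable f.
Proof.
move=> [a [p ->]]; apply: cmeasurableM; last exact: cmeasurable_polyfun.
have -> : (fun z => conjc (pt z) ^+ a) = (fun z : circleB R => conjc (polyfun 'X^a z)).
  by apply/funext => z; rewrite /polyfun hornerXn rmorphXn.
by apply: cmeasurableJ; exact: cmeasurable_polyfun.
Qed.

(** For unimodular [w] this is the cosine in the direction of conj w, rescaled from [-1, 1] to the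
    interval where [step_approximation] applies; its sublevel sets are the half-planes. *)
Definition half_cosine (w : R[i]) (z : circleB R) : R := (1 + complex.Re (w * pt z)) / 2.

Lemma trigpoly_half_cosine w : trigpoly (fun z => Complex (half_cosine w z) 0).
Proof.
have -> : (fun z => Complex (half_cosine w z) 0) = (fun z => Complex 2^-1 0 +
    (Complex 4^-1 0 * w * pt z + Complex 4^-1 0 * conjc w * conjc (pt z))).
  apply/funext => z; rewrite /half_cosine; case: w (pt z) => a b [c d].
  by apply/eqP; rewrite eq_complex /=; apply/andP; split; apply/eqP; field.
apply: trigpolyD; first exact: trigpoly_cst.
apply: trigpolyD; apply: trigpolyM; try exact: trigpoly_cst.
  by exists 0%N, 'X; apply/funext => z; rewrite expr0 mul1r hornerX.
by exists 1%N, 1; apply/funext => z; rewrite expr1 hornerC mulr1.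
Qed.

Lemma half_cosine_itv w z : sqn w = 1 -> 0 <= half_cosine w z <= 1.
Proof.
move=> w1; have := Re_le_cabs (w * pt z).
by rewrite -sqrt_sqn sqnM w1 sqn_pt mulr1 sqrtr1 ler_norml /half_cosine; lra.
Qed.

(* Stability under finite intersections comes from multiplying the approximants. *)
Definition trig_approximable (A : set (circleB R)) : Prop := measurable A /\
  exists h : nat -> circleB R -> R,
  [/\ forall n, trigpoly (fun z => Complex (h n z) 0),
      forall n z, 0 <= h n z <= 1 &
      forall z, h n z @[n --> \oo] --> (\1_A z : R)].

Lemma trig_approximable_setI : setI_closed trig_approximable.
Proof.
move=> A B [mA [h [ht h01 hA]]] [mB [k [kt k01 kB]]].
split; first exact: measurableI.
exists (fun n z => h n z * k n z); split => [n|n z|z].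
- have -> : (fun z => Complex (h n z * k n z) 0) =
      (fun z => Complex (h n z) 0 * Complex (k n z) 0).
    by apply/funext => z; apply/eqP; rewrite eq_complex /=; apply/andP; split; apply/eqP; ring.
  exact: trigpolyM.
- have /andP[? ?] := h01 n z; have /andP[? ?] := k01 n z.
  by rewrite mulr_ge0 // mulr_ile1.
- by rewrite indicI; apply: cvgM.
Qed.

Lemma trig_approximable_halfplane (w : R[i]) (t : R) : sqn w = 1 ->
  trig_approximable [set z | complex.Re (w * pt z) < t].
Proof.
move=> w1; split.
  have [mw _] : cmeasurable (fun z => w * polyfun 'X z : R[i]).
    by apply: cmeasurableZ; exact: cmeasurable_polyfun.
  have := mw measurableT `]-oo, t[%classic (measurable_itv _).
  rewrite setTI; set A := (X in measurable X); suff -> : A = [set z | complex.Re (w * pt z) < t] by [].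
  by rewrite /A; apply/seteqP; split=> z /=; rewrite /polyfun hornerX in_itv.
have Re1 z : -1 <= complex.Re (w * pt z) <= 1.
  by have := half_cosine_itv z w1; rewrite /half_cosine; lra.
have E z : [set z | complex.Re (w * pt z) < t] z = (half_cosine w z < (1 + t) / 2)%R :> Prop.
  by rewrite /half_cosine ltr_pM2r ?invr_gt0 // ltrD2l.
have IE z : \1_[set z | complex.Re (w * pt z) < t] z = ((half_cosine w z < (1 + t) / 2)%R%:R : R).
  by rewrite indicE; congr (_%:R); congr nat_of_bool; apply/idP/idP; rewrite inE E.
(* The step lemma wants a threshold in ]0, 1], that is -1 < t <= 1. For the other values of [t] the
   half-plane misses the circle or contains it, and constants do. *)
have [t1|t1] := leP t (-1).
  exists (fun _ _ => 0); split=> [n|n z|z]; [exact: trigpoly_cst|by rewrite lexx ler01|].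
  rewrite IE (_ : (_ < _) = false); first exact: cvg_cst.
  by apply/negbTE; rewrite -leNgt; have := half_cosine_itv z w1; lra.
have [t2|t2] := leP t 1; last first.
  exists (fun _ _ => 1); split=> [n|n z|z]; [exact: trigpoly_cst|by rewrite lexx ler01|].
  rewrite IE (_ : (_ < _) = true); first exact: cvg_cst.
  by have := half_cosine_itv z w1; lra.
have [|N hN] := @step_approximation R ((1 + t) / 2); first by lra.
exists (fun n z => (1 - half_cosine w z ^+ n) ^+ N n); split=> [n|n z|z]; last first.
- by rewrite IE; apply: hN; exact: half_cosine_itv.
- have /andP[u0 u1] := half_cosine_itv z w1.
  have un1 : half_cosine w z ^+ n <= 1 by rewrite exprn_ile1.
  have un0 : 0 <= half_cosine w z ^+ n by rewrite exprn_ge0.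
  by rewrite exprn_ge0 ?subr_ge0 //= exprn_ile1 ?subr_ge0 // lerBlDr lerDl.
- have realX (a : R) m : (Complex a 0) ^+ m = Complex (a ^+ m) 0.
    by rewrite [Complex a 0](_ : _ = a%:C%C) // -rmorphXn.
  have -> : (fun z => Complex ((1 - half_cosine w z ^+ n) ^+ N n) 0) =
      (fun z => (1 + (-1) * Complex (half_cosine w z) 0 ^+ n) ^+ N n).
    apply/funext => z; rewrite realX.
    have -> (x : R) : 1 + (-1) * Complex x 0 = Complex (1 - x) 0.
      by apply/eqP; rewrite eq_complex /=; apply/andP; split; apply/eqP; ring.
    by rewrite realX.
  apply: trigpolyX; apply: trigpolyD; first exact: trigpoly_cst.
  apply: trigpolyM; first exact: trigpoly_cst.
  by apply: trigpolyX; exact: trigpoly_half_cosine.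
Qed.

(** An open set is a countable union of rectangles with rational sides, each of them the
    intersection of four half-planes. *)
Lemma borel_trig_approximable :
  @measurable _ (circleB R) = <<s trig_approximable >>.
Proof.
rewrite /measurable /=; apply/seteqP; split; last first.
  by apply: smallest_sub; [exact: smallest_sigma_algebra|move=> A []].
apply: smallest_sub; first exact: smallest_sigma_algebra.
move=> U oU.
(* The four directions 1, -1, i, -i bound Re z, - Re z, - Im z and Im z from above, since Re (i z) =
   - Im z. *)
pose rect (q : rat * rat * (rat * rat)) : set (circleB R) :=
  ([set z | complex.Re (1 * pt z) < ratr q.1.1] `&`
   [set z | complex.Re (-1 * pt z) < ratr q.1.2]) `&`
  ([set z | complex.Re (Complex 0 1 * pt z) < ratr q.2.1] `&`
   [set z | complex.Re (Complex 0 (-1) * pt z) < ratr q.2.2]).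
have mrect q : trig_approximable (rect q).
  by do !apply: trig_approximable_setI; apply: trig_approximable_halfplane;
    rewrite /sqn /=; ring.
(* Rectangles that leave [U] are replaced by the empty set, so the union runs over all of a
   countable index type. *)
pose F q := if pselect (rect q `<=` U) then rect q else set0.
have -> : U = \bigcup_q F q.
  apply/seteqP; split=> [z Uz|z [q _]]; last by rewrite /F; case: pselect => // qU /qU.
  have [d d0 dU] := open_circle_square oU Uz.
  have itv (x : R) : exists2 q : rat, x < ratr q & ratr q < x + d.
    have /rat_in_itvoo[q] : x < x + d by rewrite ltrDl.
    by rewrite in_itv /= => /andP[? ?]; exists q.
  have [a a1 a2] := itv (complex.Re (pt z)).
  have [b b1 b2] := itv (- complex.Re (pt z)).
  have [c c1 c2] := itv (- complex.Im (pt z)).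
  have [e e1 e2] := itv (complex.Im (pt z)).
  exists ((a, b), (c, e)) => //; rewrite /F; case: pselect => [?|].
    by move: a1 b1 c1 e1; rewrite /rect /=; case: (pt z) => x y /= *; split; split; lra.
  case=> w; have := dU w; rewrite -/(pt w) -/(pt z) /rect /= => dw [[]].
  move: a1 a2 b1 b2 c1 c2 e1 e2 dw.
  case: (pt z) (pt w) => x y [x' y'] /= a1 a2 b1 b2 c1 c2 e1 e2 dw h1 h2 [h3 h4].
  by apply: dw; rewrite ltr_norml; apply/andP; split; lra.
apply: (@countable_bigcupT_measurable _ (g_sigma_algebraType trig_approximable)) => //.
move=> q; rewrite /F; case: pselect => ?; last exact: measurable0.
exact: sub_sigma_algebra.
Qed.

End trigonometric_polynomials.

(** * From trigonometric polynomials to all square-integrable functions *)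

Section density_of_trigonometric_polynomials.
Import HBSimple HBNNSimple.
Context {R : realType}.
Variables (mu : probability (circleB R) R) (E : set (circleB R -> R[i])).
Hypotheses (E0 : E (fun=> 0)) (Em : E `<=` cmeasurable).
Hypothesis ED : forall f g, E f -> E g -> E (fun z => f z + g z).
Hypothesis EZ : forall c f, E f -> E (fun z => c * f z).
Hypothesis Etrig : forall f, trigpoly f -> approximable mu E f.

Local Notation appr := (approximable mu E).

Local Notation indc A := (fun z => Complex (\1_A z) 0 : R[i]).

Lemma cvg_sqrB (u : nat -> R) (l : R) : u n @[n --> \oo] --> l ->
  (l - u n) ^+ 2 @[n --> \oo] --> (0 : R).
Proof.
move=> ul; have d0 : l - u n @[n --> \oo] --> (0 : R).
  by rewrite -(subrr l); apply: cvgB => //; exact: cvg_cst.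
rewrite -[0](mulr0 0) (_ : (fun n => _) = (fun n => (l - u n) * (l - u n))).
  exact: cvgM.
by apply/funext => n; rewrite expr2.
Qed.

Lemma approximable_bounded_cvg (h_ : nat -> circleB R -> R) (h : circleB R -> R) :
  (forall n, appr (fun z => Complex (h_ n z) 0)) -> measurable_fun setT h ->
  (forall n z, `|h z - h_ n z| <= 1) ->
  (forall z, h_ n z @[n --> \oo] --> h z) ->
  appr (fun z => Complex (h z) 0).
Proof.
move=> ah mh h1 hh; have E1 n z : sqn (Complex (h z) 0 - Complex (h_ n z) 0) = (h z - h_ n z) ^+ 2.
  by rewrite -sqn_real; congr sqn; apply/eqP; rewrite eq_complex /= subr0 !eqxx.
apply: (approximable_dominated_cvg Em (G := fun=> 1) ah).
- exact: cmeasurable_real.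
- by apply: (bounded_integrable _ (C := 1)) => [|z]; [exact: measurable_cst|rewrite normr1].
- by move=> n z; rewrite E1 -real_normK ?num_real // expr_le1.
- by move=> z; under eq_fun do rewrite E1; exact: cvg_sqrB.
Qed.

Lemma approximable_indic (A : set (circleB R)) : measurable A -> appr (indc A).
Proof.
rewrite borel_trig_approximable; move: A; apply: dynkin_induction.
- exact: borel_trig_approximable.
- exact: trig_approximable_setI.
- apply: Etrig; rewrite indicT; exact: (trigpoly_cst (Complex 1 0)).
- move=> A [mA [h [ht h01 hA]]]; apply: (@approximable_bounded_cvg h) => //.
  + by move=> n; exact: Etrig.
  + move=> n z; have /andP[? ?] := h01 n z; rewrite indicE ler_norml.
    by case: (_ \in _) => /=; lra.
- move=> A mA aA; have -> : indc (~` A) = (fun z => 1 + (-1) * (Complex (\1_A z) 0)).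
    apply/funext => z; rewrite indicC indicE; case: (_ \in _); apply/eqP;
    by rewrite eq_complex /=; apply/andP; split; apply/eqP; ring.
  apply: (approximableD Em ED); last exact: (approximableZ Em EZ).
  by apply: Etrig; exact: trigpoly_cst.
- move=> F mF tF aF.
  (* By disjointness only the j-th term is nonzero at z. Partial sums therefore take only the values
     0 and 1, which provides the bound for dominated convergence. *)
  have S1 n z j : F j z -> \sum_(0 <= k < n) \1_(F k) z = (j < n)%N%:R :> R.
    move=> Fj; have IE k : \1_(F k) z = (k == j)%:R :> R.
      rewrite indicE; congr (_%:R); congr nat_of_bool.
      apply/idP/eqP => [|->]; rewrite inE // => Fk.
      by apply: tF => //; exists z.
    elim: n => [|n IH]; first by rewrite big_nil ltn0.
    rewrite big_nat_recr //= IH IE -natrD ltnS; congr (_%:R).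
    by case: ltngtP.
  have S0 n z : ~ (\bigcup_k F k) z -> \sum_(0 <= k < n) \1_(F k) z = 0 :> R.
    move=> nF; rewrite big1 // => k _; rewrite indicE memNset // => Fk.
    by apply: nF; exists k.
  apply: (@approximable_bounded_cvg (fun n z => \sum_(0 <= k < n) \1_(F k) z)).
  + move=> n.
    have -> : (fun z => Complex (\sum_(0 <= k < n) \1_(F k) z) 0) =
        (fun z => \sum_(0 <= k < n) indc (F k) z).
      by apply/funext => z; rewrite -(rmorph_sum (real_complex R)).
    exact: (approximable_sum E0 Em ED).
  + by apply: measurable_indic; exact: bigcupT_measurable.
  + move=> n z; have [Fz|nF] := pselect ((\bigcup_k F k) z).
      have [j _ Fj] := Fz; rewrite (S1 _ _ _ Fj) indicE mem_set //.
      by case: (j < n)%N; rewrite ?subrr ?normr0 ?subr0 ?normr1.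
    by rewrite S0 // indicE memNset // subrr normr0.
  + move=> z; have [Fz|nF] := pselect ((\bigcup_k F k) z).
      have [j _ Fj] := Fz; rewrite indicE mem_set //.
      apply/cvgrPdist_lt => e e0; exists j.+1 => // n /= jn.
      by rewrite (S1 _ _ _ Fj) jn subrr normr0.
    under eq_fun do rewrite S0 //.
    by rewrite indicE memNset //; exact: cvg_cst.
Qed.

(** Simple functions g_n increase to [h] with 0 <= g_n <= h, so (h - g_n)^2 is dominated by the
    integrable function h^2. *)
Lemma approximable_nonneg (h : circleB R -> R) : measurable_fun setT h ->
  (forall z, 0 <= h z) -> mu.-integrable setT (fun z => (h z ^+ 2)%:E) ->
  appr (fun z => Complex (h z) 0).
Proof.
move=> mh h0 ih.
have mEh : measurable_fun setT (EFin \o h) by exact/measurable_EFinP.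
have [|g [nd_g gh]] := approximation measurableT mEh.
  by move=> z _; rewrite lee_fin.
have {}gh z : g n z @[n --> \oo] --> h z.
  have /fine_cvgP[_] := gh z I.
  by apply: cvg_trans; apply: near_eq_cvg; exact: nearW.
have g_le n z : g n z <= h z.
  rewrite -(cvg_lim _ (gh z)) //; apply: (@nondecreasing_cvgn_le _ (fun n => g n z)).
    by move=> a b /nd_g /lefP.
  by apply/cvg_ex; exists (h z).
have E1 n z : sqn (Complex (h z) 0 - Complex (g n z) 0) = (h z - g n z) ^+ 2.
  by rewrite -sqn_real; congr sqn; apply/eqP; rewrite eq_complex /= subr0 !eqxx.
apply: (approximable_dominated_cvg Em (f_ := fun n z => Complex (g n z) 0) (G := fun z => h z ^+ 2)).
- move=> n; pose s := fset_set (range (g n)).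
  have -> : (fun z => Complex (g n z) 0) =
      (fun z => \sum_(i < #|`s|) Complex s`_i 0 * indc (g n @^-1` [set s`_i]) z).
    apply/funext => z; rewrite (fimfunEord (g n)) -/s.
    rewrite [LHS](_ : _ = (\sum_(i < #|`s|) (s`_i * \1_(g n @^-1` [set s`_i]) z))%:C%C) //.
    by rewrite rmorph_sum; apply: eq_bigr => i _; rewrite rmorphM.
  apply: (approximable_sum E0 Em ED) => i.
  apply: (approximableZ Em EZ); apply: approximable_indic.
  exact: measurable_funPTI.
- exact: cmeasurable_real.
- exact: ih.
- move=> n z; rewrite E1 lerXn2r ?nnegrE ?subr_ge0 //.
  by rewrite lerBlDr lerDl.
- by move=> z; under eq_fun do rewrite E1; exact: cvg_sqrB.
Qed.

(** The positive and negative parts of [h] inherit square-integrability from [k]. Taking for [k] the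
    complex function itself handles its real and imaginary parts alike. *)
Lemma approximable_real (h : circleB R -> R) (k : circleB R -> R[i]) :
  measurable_fun setT h -> L2 mu k -> (forall z, h z ^+ 2 <= sqn (k z)) ->
  appr (fun z => Complex (h z) 0).
Proof.
move=> mh [mk /L2normy ky] hk.
have ihp (u : circleB R -> R) : measurable_fun setT u ->
    (forall z, u z ^+ 2 <= h z ^+ 2) -> mu.-integrable setT (fun z => (u z ^+ 2)%:E).
  move=> mu_ uh; apply/integrableP; split.
    by apply/measurable_EFinP; exact: measurable_funX.
  apply: le_lt_trans ky; apply: ge0_le_integral => //.
  - by apply: measurableT_comp => //; apply/measurable_EFinP; exact: measurable_funX.
  - by apply/measurable_EFinP; exact: measurable_sqn.
  - move=> z _; rewrite gee0_abs ?lee_fin ?sqr_ge0 //.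
    exact: le_trans (hk z).
have -> : (fun z => Complex (h z) 0) =
    (fun z => Complex (h^\+ z) 0 + (-1) * Complex (h^\- z) 0).
  apply/funext => z; have -> : h z = h^\+ z - h^\- z.
    by rewrite -[in LHS](funrposBneg h).
  by apply/eqP; rewrite eq_complex /=; apply/andP; split; apply/eqP; ring.
apply: (approximableD Em ED); last apply: (approximableZ Em EZ);
  apply: approximable_nonneg.
- exact: measurable_funrpos.
- by move=> z; exact: funrpos_ge0.
- apply: ihp; first exact: measurable_funrpos.
  by move=> z; rewrite /funrpos; case: (leP (h z) 0) => _; rewrite ?lexx // expr0n sqr_ge0.
- exact: measurable_funrneg.
- by move=> z; exact: funrneg_ge0.
- apply: ihp; first exact: measurable_funrneg.
  by move=> z; rewrite /funrneg; case: (leP (- h z) 0) => _; rewrite ?sqrrN ?lexx // expr0n sqr_ge0.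
Qed.

Lemma approximable_L2 f : L2 mu f -> appr f.
Proof.
move=> L2f; have [[mr mi] _] := L2f.
have -> : f = (fun z => Complex (complex.Re (f z)) 0 + Complex 0 1 * Complex (complex.Im (f z)) 0).
  by apply/funext => z; rewrite {1}[f z]complexE.
apply: (approximableD Em ED); last apply: (approximableZ Em EZ);
  apply: approximable_real L2f _ => // z; first by rewrite lerDl sqr_ge0.
by rewrite lerDr sqr_ge0.
Qed.

End density_of_trigonometric_polynomials.

(** * Orthogonal polynomials *)

Section inner_product.
Context {R : realType}.
Variable mu : probability (circleB R) R.
Implicit Types (f g h : circleB R -> R[i]) (p q : {poly R[i]}).

(** A class that contains the polynomials, is closed under products and conjugation, and is
    integrable for a probability; inside it the rules of the inner product hold without further side
    conditions. *)
Definition bounded_measurable f : Prop :=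
  cmeasurable f /\ exists C : R, forall z, sqn (f z) <= C.

Lemma bounded_measurable_poly p : bounded_measurable (polyfun p).
Proof.
split; first exact: cmeasurable_polyfun.
elim/poly_ind: p => [|p c [C hC]].
  by exists 0 => z; rewrite /polyfun horner0 /sqn /= expr0n addr0.
exists (2 * (C + sqn c)) => z; rewrite /polyfun hornerMXaddC.
apply: le_trans (sqnD_le _ _) _.
by rewrite ler_wpM2l // lerD2r sqnM sqn_pt mulr1 hC.
Qed.

Lemma bounded_measurableM f g :
  bounded_measurable f -> bounded_measurable g -> bounded_measurable (fun z => f z * g z).
Proof.
move=> [mf [C fC]] [mg [D gD]]; split; first exact: cmeasurableM.
by exists (C * D) => z; rewrite sqnM ler_pM ?sqn_ge0.
Qed.

Lemma bounded_measurableD f g :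
  bounded_measurable f -> bounded_measurable g -> bounded_measurable (fun z => f z + g z).
Proof.
move=> [mf [C fC]] [mg [D gD]]; split; first exact: cmeasurableD.
exists (2 * (C + D)) => z; apply: le_trans (sqnD_le _ _) _.
by rewrite ler_wpM2l // lerD.
Qed.

Lemma bounded_measurableJ f :
  bounded_measurable f -> bounded_measurable (fun z => conjc (f z)).
Proof.
move=> [mf [C fC]]; split; first exact: cmeasurableJ.
by exists C => z; rewrite sqnJ.
Qed.

Lemma bounded_measurable_cst (c : R[i]) : bounded_measurable (fun=> c).
Proof. by split; [exact: cmeasurable_cst|exists (sqn c)]. Qed.

Lemma bounded_measurable_integrable f : bounded_measurable f ->
  mu.-integrable setT (EFin \o (fun z => complex.Re (f z))) /\
  mu.-integrable setT (EFin \o (fun z => complex.Im (f z))).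
Proof.
move=> [[mr mi] [C fC]]; have hC z : cabs (f z) <= `|C| + 1.
  have := fC z; rewrite sqn_cabs; have := cabs_ge0 (f z).
  have := ler_norm C; have := normr_ge0 C; nra.
split; apply: (bounded_integrable _ (C := `|C| + 1)) => // z.
  exact: le_trans (Re_le_cabs _) _.
exact: le_trans (Im_le_cabs _) _.
Qed.

Lemma cintegralD f g : bounded_measurable f -> bounded_measurable g ->
  cintegral mu (fun z => f z + g z) = cintegral mu f + cintegral mu g.
Proof.
move=> /bounded_measurable_integrable[fr fi] /bounded_measurable_integrable[gr gi].
rewrite /cintegral; apply/eqP; rewrite eq_complex /=; apply/andP; split; apply/eqP.
- rewrite -RintegralD //; congr Rintegral; apply/funext => z.
  by case: (f z) (g z) => ? ? [].
- rewrite -RintegralD //; congr Rintegral; apply/funext => z.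
  by case: (f z) (g z) => ? ? [].
Qed.

Lemma cintegralZ (c : R[i]) f : bounded_measurable f ->
  cintegral mu (fun z => c * f z) = c * cintegral mu f.
Proof.
move=> /bounded_measurable_integrable[fr fi].
have Zi (a : R) (u : circleB R -> R) : mu.-integrable setT (EFin \o u) ->
    mu.-integrable setT (EFin \o (fun z => a * u z)).
  by move=> /(integrableZl measurableT a).
case: c => a b; rewrite /cintegral; apply/eqP; rewrite eq_complex /=; apply/andP; split; apply/eqP.
- rewrite -!RintegralZl // -RintegralB //; try exact: Zi.
  by congr Rintegral; apply/funext => z; case: (f z).
- rewrite -!RintegralZl // -RintegralD //; try exact: Zi.
  by congr Rintegral; apply/funext => z; case: (f z).
Qed.

Lemma cintegralJ f : bounded_measurable f ->
  cintegral mu (fun z => conjc (f z)) = conjc (cintegral mu f).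
Proof.
move=> /bounded_measurable_integrable[fr fi].
rewrite /cintegral; apply/eqP; rewrite eq_complex /=; apply/andP; split; apply/eqP.
- by congr Rintegral; apply/funext => z; case: (f z).
- rewrite -mulN1r -RintegralZl //.
  by congr Rintegral; apply/funext => z; case: (f z) => x y /=; rewrite mulN1r.
Qed.

(** [fine] sends an infinite value to 0, so this is the squared norm when that norm is finite, in
    particular for bounded functions. *)
Definition sqnorm f : R := fine (N2 mu f).

Lemma N2_sqnorm f : bounded_measurable f -> N2 mu f = (sqnorm f)%:E.
Proof.
move=> [mf [C fC]]; rewrite /sqnorm fineK // ge0_fin_numE ?N2_ge0 //.
by apply: le_lt_trans (N2_bounded mu mf fC) _; rewrite ltry.
Qed.

Lemma sqnorm_ge0 f : 0 <= sqnorm f.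
Proof. by rewrite fine_ge0 // N2_ge0. Qed.

Lemma eq_sqnorm f g : (forall z, sqn (f z) = sqn (g z)) -> sqnorm f = sqnorm g.
Proof. by move=> fg; rewrite /sqnorm /N2; under eq_integral do rewrite fg. Qed.

Lemma L2dot_self f : L2dot mu f f = Complex (sqnorm f) 0.
Proof.
rewrite /L2dot /cintegral; congr Complex.
  by congr (fine _); apply: eq_integral => z _; rewrite Re_sqn.
under eq_Rintegral do rewrite Im_mulJ.
by rewrite /Rintegral integral0.
Qed.

Lemma eq_L2dot f g f' g' : (forall z, f z * conjc (g z) = f' z * conjc (g' z)) ->
  L2dot mu f g = L2dot mu f' g'.
Proof. by move=> fg; rewrite /L2dot; congr cintegral; apply/funext. Qed.

Section sesquilinear.
Variables f g h : circleB R -> R[i].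
Hypotheses (bf : bounded_measurable f) (bg : bounded_measurable g) (bh : bounded_measurable h).

Lemma L2dotDl : L2dot mu (fun z => f z + g z) h = L2dot mu f h + L2dot mu g h.
Proof.
rewrite /L2dot -cintegralD; try by apply: bounded_measurableM => //; exact: bounded_measurableJ.
by congr cintegral; apply/funext => z; rewrite mulrDl.
Qed.

Lemma L2dotZl c : L2dot mu (fun z => c * f z) h = c * L2dot mu f h.
Proof.
rewrite /L2dot -cintegralZ; last by apply: bounded_measurableM => //; exact: bounded_measurableJ.
by congr cintegral; apply/funext => z; rewrite mulrA.
Qed.

Lemma L2dotJ : L2dot mu g f = conjc (L2dot mu f g).
Proof.
rewrite /L2dot -cintegralJ; last by apply: bounded_measurableM => //; exact: bounded_measurableJ.
by congr cintegral; apply/funext => z; rewrite conjcM conjcK mulrC.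
Qed.

End sesquilinear.

Lemma L2dotDr f g h : bounded_measurable f -> bounded_measurable g -> bounded_measurable h ->
  L2dot mu h (fun z => f z + g z) = L2dot mu h f + L2dot mu h g.
Proof.
move=> bf bg bh; rewrite (L2dotJ (bounded_measurableD bf bg) bh) L2dotDl // conjcD.
by rewrite -!L2dotJ.
Qed.

Lemma L2dotZr c f h : bounded_measurable f -> bounded_measurable h ->
  L2dot mu h (fun z => c * f z) = conjc c * L2dot mu h f.
Proof.
move=> bf bh; rewrite (L2dotJ (bounded_measurableM (bounded_measurable_cst c) bf) bh).
by rewrite L2dotZl // conjcM -L2dotJ.
Qed.

Lemma sqnormD f g : bounded_measurable f -> bounded_measurable g ->
  L2dot mu f g = 0 -> sqnorm (fun z => f z + g z) = sqnorm f + sqnorm g.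
Proof.
move=> bf bg fg0; have bfg := bounded_measurableD bf bg.
have : L2dot mu (fun z => f z + g z) (fun z => f z + g z) =
    L2dot mu f f + L2dot mu g g.
  rewrite L2dotDl // !L2dotDr // (L2dotJ bf bg) fg0 conjc0; ring.
by rewrite !L2dot_self => -[].
Qed.

Lemma sqnormZ c f : bounded_measurable f ->
  sqnorm (fun z => c * f z) = sqn c * sqnorm f.
Proof.
by move=> bf; rewrite /sqnorm N2Z; [rewrite N2_sqnorm|exact: bf.1].
Qed.

(** A nonzero polynomial has finitely many roots, so some point of the infinite support is not a
    root. Near it |p|^2 exceeds a positive constant, on an open set of positive measure. *)
Lemma sqnorm_poly_gt0 p : infinitely_supported mu -> p != 0 -> 0 < sqnorm (polyfun p).
Proof.
move=> infS p0.
have [z0 Sz0 pz0] : exists2 z0, msupport mu z0 & p.[cval z0] != 0.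
  apply: contrapT => noz; have [B BS Bn] := infinite_set_fset (size p) infS.
  suff : (size [seq cval z | z <- B] < size p)%N by rewrite size_map ltnNge Bn.
  apply: max_poly_roots => //.
    apply/allP => _ /mapP[z /BS Sz ->]; rewrite rootE; apply: contrapT => nz.
    by apply: noz; exists z => //; apply/negP.
  by rewrite map_inj_uniq ?fset_uniq //; exact: val_inj.
pose d := sqn (p.[cval z0]) / 2.
have d0 : 0 < d.
  rewrite divr_gt0 // lt_neqAle sqn_ge0 andbT eq_sym; apply: contra pz0 => /eqP.
  by move=> /sqn_eq0 ->.
pose U := [set z : circle R | d < sqn (p.[cval z])].
have oU : open U.
  have [cr ci] := continuous_poly_cval p.
  have cs : continuous (fun z : circle R => sqn (p.[cval z]) : R).
    have gen (T : topologicalType) (u v : T -> R) : continuous u -> continuous v ->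
        continuous (fun z => u z ^+ 2 + v z ^+ 2).
      by move=> cu cv z; apply: cvgD; rewrite expr2; under eq_fun do rewrite expr2;
        apply: cvgM; [exact: cu|exact: cu|exact: cv|exact: cv].
    exact: gen.
  have -> : U = (fun z : circle R => sqn (p.[cval z])) @^-1` `]d, +oo[%classic.
    by apply/seteqP; split=> z /=; rewrite in_itv /= andbT.
  by move/continuousP : cs; apply; exact: interval_open.
have mU : measurable (U : set (circleB R)) by exact: sub_sigma_algebra.
have Uz0 : U z0 by rewrite /U /= ltr_pdivrMr // ltr_pMr ?ltr1n // -(pmulr_lgt0 _ (_ : 0 < 2^-1)) ?invr_gt0.
have muU := Sz0 U oU Uz0.
have bp := bounded_measurable_poly p.
rewrite -lte_fin -N2_sqnorm //; apply: (@lt_le_trans _ _ (d%:E * mu U)%E).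
  by rewrite mule_gt0 // lte_fin.
rewrite -[U in mu U]setIT -(integral_indic mu measurableT mU).
rewrite -ge0_integralZl_EFin ?(ltW d0) //; first last.
- by apply/measurable_EFinP; exact: measurable_indic.
apply: ge0_le_integral => //.
- by move=> z _; rewrite mule_ge0 ?lee_fin ?(ltW d0).
- by apply/measurable_funeM/measurable_EFinP; exact: measurable_indic.
- by apply/measurable_EFinP; apply: measurable_sqn; exact: bp.1.
- move=> z _; rewrite -EFinM lee_fin indicE; case: (boolP (z \in _)).
    by rewrite inE mulr1 => /ltW.
  by rewrite mulr0 sqn_ge0.
Qed.

End inner_product.

(** * The Szego recurrence *)

Section szego.
Context {R : realType}.
Variable mu : probability (circleB R) R.
Hypothesis infmu : infinitely_supported mu.
Implicit Types (p q A B : {poly R[i]}).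

Local Notation bmp := bounded_measurable_poly.

Lemma L2dot_polyDr p q r :
  L2dot mu (polyfun p) (polyfun (q + r)) =
  L2dot mu (polyfun p) (polyfun q) + L2dot mu (polyfun p) (polyfun r).
Proof.
rewrite -L2dotDr; try exact: bmp.
by congr L2dot; apply/funext => z; rewrite /polyfun hornerD.
Qed.

Lemma L2dot_polyDl p q r :
  L2dot mu (polyfun (p + q)) (polyfun r) =
  L2dot mu (polyfun p) (polyfun r) + L2dot mu (polyfun q) (polyfun r).
Proof.
rewrite -L2dotDl; try exact: bmp.
by congr L2dot; apply/funext => z; rewrite /polyfun hornerD.
Qed.

Lemma L2dot_polyZl c p q :
  L2dot mu (polyfun (c%:P * p)) (polyfun q) = c * L2dot mu (polyfun p) (polyfun q).
Proof.
rewrite -L2dotZl; try exact: bmp.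
by congr L2dot; apply/funext => z; rewrite /polyfun hornerCM.
Qed.

Lemma L2dot_polyZr c p q :
  L2dot mu (polyfun p) (polyfun (c%:P * q)) = conjc c * L2dot mu (polyfun p) (polyfun q).
Proof.
rewrite -L2dotZr; try exact: bmp.
by congr L2dot; apply/funext => z; rewrite /polyfun hornerCM.
Qed.

Lemma L2dot_polyX p q :
  L2dot mu (polyfun (p * 'X)) (polyfun (q * 'X)) = L2dot mu (polyfun p) (polyfun q).
Proof.
apply: eq_L2dot => z; rewrite /polyfun !hornerMX conjcM.
by rewrite mulrACA pt_mulJ mulr1.
Qed.

(** The leading terms cancel in p - q, so this difference has degree below n and is orthogonal to
    itself. *)
Lemma monic_orthogonal_unique n p q :
  is_monic_orthogonal mu n p -> is_monic_orthogonal mu n q -> p = q.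
Proof.
move=> [mp sp op] [mq sq oq]; apply/eqP; rewrite -subr_eq0; apply/negPn/negP => pq0.
have spq : (size (p - q)%R <= n)%N.
  apply/leq_sizeP => j; rewrite leq_eqVlt => /predU1P[<-|nj].
    rewrite coefB; move: mp mq; rewrite !monicE /lead_coef sp sq /= => /eqP -> /eqP ->.
    by rewrite subrr.
  by rewrite coefB !nth_default ?sp ?sq // subrr.
have := sqnorm_poly_gt0 infmu pq0.
suff : L2dot mu (polyfun (p - q)) (polyfun (p - q)) = 0.
  by rewrite L2dot_self => -[->]; rewrite ltxx.
by rewrite -[- q]mulN1r -[- 1]polyCN L2dot_polyDl L2dot_polyZl polyCN mulN1r op // oq // mulr0 addr0.
Qed.

(* [B] is the reversed polynomial [Phi_n^*] when [A] is [Phi_n]. *)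
Definition szego_pair (n : nat) A B : Prop :=
  [/\ is_monic_orthogonal mu n A, (size B <= n.+1)%N, B`_0 = 1,
      forall z : circleB R, B.[pt z] = pt z ^+ n * conjc A.[pt z] &
      forall i, cabs A`_i <= 'C(n, i)%:R /\ cabs B`_i <= 'C(n, i)%:R].

Lemma szego_pair0 : szego_pair 0 1 1.
Proof.
have c1 i : cabs (1 : {poly R[i]})`_i <= ('C(0, i)%:R : R).
  rewrite coef1 bin0n; case: (i == 0)%N; first by rewrite cabs1.
  by rewrite cabs0.
split=> //.
- split; [exact: monic1|by rewrite size_poly1|move=> q].
  rewrite leqn0 size_poly_eq0 => /eqP ->.
  have -> : (0 : {poly R[i]}) = 0%:P * 0 by rewrite mulr0.
  by rewrite L2dot_polyZr conjc0 mul0r.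
- by rewrite size_poly1.
- by rewrite coef1.
- by move=> z; rewrite expr0 hornerC mul1r conjc1.
Qed.

(** Here [r] is z^(n-1) conj q, whose coefficients are those of q conjugated and in reverse order.
    The extra factor z in the equation lets it cover n = 0 as well. *)
Lemma reversed_poly n q : (size q <= n)%N -> exists2 r : {poly R[i]}, (size r <= n)%N &
  forall z : circleB R, r.[pt z] * pt z = pt z ^+ n * conjc q.[pt z].
Proof.
move=> sq; exists (\poly_(i < n) conjc q`_(n.-1 - i)); first exact: size_poly.
move=> z; rewrite horner_poly (horner_coef_wide _ sq) (raddf_sum conjc) mulr_sumr mulr_suml.
rewrite (reindex_inj rev_ord_inj) /=; apply: eq_bigr => i _.
have -> : (n.-1 - (n - i.+1) = i)%N by have := ltn_ord i; lia.
rewrite conjcM rmorphXn /= -mulrA -exprSr.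
have -> : pt z ^+ n = pt z ^+ (n - i.+1).+1 * pt z ^+ i.
  by rewrite -exprD; congr (_ ^+ _); have := ltn_ord i; lia.
have -> (x y u w : R[i]) : x * y * (u * w) = u * x * (w * y) by ring.
by rewrite ptJ_mul mulr1.
Qed.

Section step.
Variables (n : nat) (A B : {poly R[i]}).
Hypothesis AB : szego_pair n A B.

(** Reversal swaps the two arguments: <z^n conj A, z q> = <z^(n-1) conj q, A>, and the left entry is
    now a polynomial of degree below n. So B is orthogonal to z, ..., z^n. *)
Lemma szego_reversed_orthogonal q : (size q <= n)%N ->
  L2dot mu (polyfun B) (polyfun (q * 'X)) = 0.
Proof.
case: AB => [[_ _ oA] _ _ Bz _] sq; have [r sr rz] := reversed_poly sq.
rewrite (@eq_L2dot _ _ _ _ (polyfun r) (polyfun A)) => [|z].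
  by rewrite (L2dotJ mu (bmp A) (bmp r)) oA // conjc0.
rewrite /polyfun hornerMX conjcM Bz.
have -> : r.[pt z] = pt z ^+ n * conjc q.[pt z] * conjc (pt z).
  by rewrite -rz -mulrA pt_mulJ mulr1.
by ring.
Qed.

Lemma sqnorm_reversed : sqnorm mu (polyfun B) = sqnorm mu (polyfun A).
Proof.
case: AB => [_ _ _ Bz _]; apply: eq_sqnorm => z.
by rewrite /polyfun Bz sqnM sqnX sqn_pt expr1n mul1r sqnJ.
Qed.

Lemma sqnorm_pair_gt0 : 0 < sqnorm mu (polyfun A).
Proof.
by case: AB => [[mA _ _] _ _ _ _]; apply: sqnorm_poly_gt0 => //; exact: monic_neq0.
Qed.

Lemma poly_shift p m : (size p <= m.+1)%N ->
  exists2 q : {poly R[i]}, (size q <= m)%N & p = q * 'X + (p`_0)%:P.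
Proof.
move=> sp; exists (\poly_(i < m) p`_i.+1); first exact: size_poly.
apply/polyP => -[|i]; rewrite coefD coefMX coefC /= ?add0r // addr0 coef_poly.
by case: ltnP => // mi; rewrite nth_default // (leq_trans sp).
Qed.

(** Both z A and B are orthogonal to z, ..., z^n, which leaves one equation, orthogonality to 1. It
    is solvable because B - 1 is a combination of z, ..., z^n, whence <B, 1> = ||B||^2 = ||A||^2 >
    0. *)
Lemma szego_step_exists : exists a : R[i],
  is_monic_orthogonal mu n.+1 (A * 'X - (conjc a)%:P * B).
Proof.
have [[mA sA oA] sB B0 Bz _] := AB.
have [r sr Br] := poly_shift sB; rewrite B0 in Br.
have B1 : L2dot mu (polyfun B) (polyfun 1) = Complex (sqnorm mu (polyfun A)) 0.
  rewrite -sqnorm_reversed -L2dot_self.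
  have -> : L2dot mu (polyfun B) (polyfun B) =
      L2dot mu (polyfun B) (polyfun (r * 'X)) + L2dot mu (polyfun B) (polyfun 1).
    by rewrite -L2dot_polyDr -Br.
  by rewrite szego_reversed_orthogonal // add0r.
have B1n0 : L2dot mu (polyfun B) (polyfun 1) != 0.
  by rewrite B1 eq_complex /= eqxx andbT gt_eqF // sqnorm_pair_gt0.
pose c := L2dot mu (polyfun (A * 'X)) (polyfun 1) / L2dot mu (polyfun B) (polyfun 1).
exists (conjc c); rewrite conjcK -mulNr -polyCN.
have sAX : size (A * 'X) = n.+2 by rewrite size_mulX ?sA // monic_neq0.
have sl : (size ((- c)%:P * B)%R < size (A * 'X)%R)%N.
  by rewrite sAX ltnS mul_polyC (leq_trans (size_scale_leq _ _)).
split.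
- by rewrite monicE lead_coefDl // -monicE monicMl // monicX.
- by rewrite size_polyDl.
- move=> q /poly_shift[s ss ->].
  rewrite L2dot_polyDr !L2dot_polyDl !L2dot_polyZl L2dot_polyX oA // szego_reversed_orthogonal //.
  rewrite -[(q`_0)%:P]mulr1 !L2dot_polyZr /c; field.
  exact: B1n0.
Qed.

(** Pythagoras for z A = A' + conj a B: A' is orthogonal to B, whose degree is at most n, and z A, A
    and B all have the same norm. *)
Lemma szego_step_sqnorm (a : R[i]) (A' : {poly R[i]}) :
  is_monic_orthogonal mu n.+1 A' ->
  (forall z : circleB R, A'.[pt z] = pt z * A.[pt z] - conjc a * B.[pt z]) ->
  sqnorm mu (polyfun A') = (1 - sqn a) * sqnorm mu (polyfun A).
Proof.
move=> [_ _ oA'] rec; have [_ sB _ _ _] := AB.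
have bB := bounded_measurableM (bounded_measurable_cst (conjc a)) (bmp B).
have := sqnormD (mu := mu) (bmp A') bB.
rewrite L2dotZr ?oA' ?mulr0; try exact: bmp; last by [].
move=> /(_ erefl); rewrite sqnormZ ?sqnJ; last exact: bmp.
rewrite sqnorm_reversed.
have -> : sqnorm mu (fun z => polyfun A' z + conjc a * polyfun B z) = sqnorm mu (polyfun A).
  apply: eq_sqnorm => z; rewrite /polyfun rec subrK sqnM sqn_pt mul1r //.
by move=> h; rewrite mulrBl mul1r {1}h addrK.
Qed.

Lemma szego_step (a : R[i]) : is_monic_orthogonal mu n.+1 (A * 'X - (conjc a)%:P * B) ->
  szego_pair n.+1 (A * 'X - (conjc a)%:P * B) (B - a%:P * (A * 'X)).
Proof.
move=> oA'; have [[mA sA oA] sB B0 Bz AB_le] := AB.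
(* By the norm identity 1 - |a|^2 is a quotient of squared norms, hence nonnegative. *)
have a1 : cabs a <= 1.
  have rec (z : circleB R) : (A * 'X - (conjc a)%:P * B).[pt z] =
      pt z * A.[pt z] - conjc a * B.[pt z].
    by rewrite hornerD hornerN hornerMX hornerCM mulrC.
  have := sqnorm_ge0 mu (polyfun (A * 'X - (conjc a)%:P * B)).
  rewrite (szego_step_sqnorm oA' rec) pmulr_lge0 ?sqnorm_pair_gt0 // subr_ge0 sqn_cabs.
  by rewrite expr_le1 // cabs_ge0.
have le_comb (c x y : R[i]) (u v : R) : cabs c <= 1 -> cabs x <= u -> cabs y <= v ->
    cabs (x - c * y) <= u + v.
  move=> c1 xu yv; apply: le_trans (cabsD_le _ _) _.
  rewrite lerD // cabsN cabsM.
  by apply: le_trans yv; rewrite -[leRHS]mul1r ler_wpM2r // cabs_ge0.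
have a1' : cabs (conjc a) <= 1 by move: a1; rewrite -!sqrt_sqn sqnJ.
split; first exact: oA'.
- apply: leq_trans (size_polyD _ _) _; rewrite geq_max (leq_trans sB) //= size_polyN.
  by rewrite mul_polyC (leq_trans (size_scale_leq _ _)) // size_mulX ?sA // monic_neq0.
- by rewrite coefB coefCM coefMX /= mulr0 subr0.
- move=> z; rewrite !(hornerD, hornerN, hornerCM, hornerMX) Bz exprSr.
  rewrite conjcD rmorphN /= !conjcM rmorphXn /= !conjcK.
  have := pt_mulJ z; have := ptJ_mul z n.
  set Z := pt z; set Zn := Z ^+ n; set x := A.[Z]; set w := conjc Z; set wn := w ^+ n.
  move=> h1 h2.
  have -> (t : R[i]) : Zn * Z * (conjc x * w - a * (wn * t)) =
    Zn * conjc x * (Z * w) - a * t * Z * (wn * Zn) by ring.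
  by rewrite h1 h2; ring.
- case=> [|i]; rewrite !coefB !coefCM !coefMX /=.
    have [hA hB] := AB_le 0%N; rewrite !bin0 in hA hB *.
    rewrite mulr0 subr0 B0 cabs1 sub0r cabsN.
    split=> //; rewrite mulr1; exact: a1'.
  (* Since |a| <= 1, a new coefficient is bounded by the sum of two neighbouring binomials, and
     Pascal's rule closes the induction. *)
  have [hA hB] := AB_le i.+1; have [hA' hB'] := AB_le i.
  rewrite binS natrD; split; last exact: le_comb.
  by rewrite [leRHS]addrC; exact: le_comb.
Qed.

End step.

(** [Phi] is obtained by choice; uniqueness identifies it with the polynomial built by the
    recurrence. *)
Lemma szego_pair_Phi n : exists B, szego_pair n (Phi mu n) B.
Proof.
have PhiE m A : is_monic_orthogonal mu m A -> Phi mu m = A.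
  by move=> oA; apply: (monic_orthogonal_unique _ oA); exact: xgetPex (ex_intro _ A oA).
elim: n => [|n [B AB]].
  by exists 1; have := szego_pair0; rewrite (PhiE _ _ (let: And5 h _ _ _ _ := szego_pair0 in h)).
have [a oA'] := szego_step_exists AB.
by rewrite (PhiE _ _ oA'); exists (B - a%:P * (Phi mu n * 'X)); exact: szego_step.
Qed.

End szego.

(** * Density of spans of monomials *)

Section markoff_decay.
Context {R : realType}.
Variable mu : probability (circleB R) R.
Hypothesis infmu : infinitely_supported mu.

Lemma Phi_monic_orthogonal n : is_monic_orthogonal mu n (Phi mu n).
Proof. by have [B []] := szego_pair_Phi infmu n. Qed.

Lemma verblunsky_recurrence n : szego_recurrence mu n (verblunsky mu n).
Proof.
have [B AB] := szego_pair_Phi infmu n.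
have [a oA'] := szego_step_exists infmu AB.
apply: (xgetPex 0); exists a => z.
rewrite (monic_orthogonal_unique infmu (Phi_monic_orthogonal n.+1) oA').
have [_ _ _ Bz _] := AB.
by rewrite hornerD hornerN hornerMX hornerCM /Phistar Bz mulrC.
Qed.

Lemma sqnorm_Phi_step n : sqnorm mu (polyfun (Phi mu n.+1)) =
  (1 - sqn (verblunsky mu n)) * sqnorm mu (polyfun (Phi mu n)).
Proof.
have [B AB] := szego_pair_Phi infmu n.
apply: (szego_step_sqnorm AB (Phi_monic_orthogonal n.+1)) => z.
by have [_ _ _ Bz _] := AB; rewrite Bz; exact: verblunsky_recurrence.
Qed.

Lemma sqnorm_Phi_anti m n : (m <= n)%N ->
  sqnorm mu (polyfun (Phi mu n)) <= sqnorm mu (polyfun (Phi mu m)).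
Proof.
move=> /subnKC <-; elim: (n - m)%N => [|j IH]; first by rewrite addn0.
apply: le_trans IH; rewrite addnS sqnorm_Phi_step -[leRHS]mul1r.
by rewrite ler_wpM2r ?sqnorm_ge0 // lerBlDr lerDl sqn_ge0.
Qed.

Lemma sqnorm_Phi0 : sqnorm mu (polyfun (Phi mu 0)) <= 1.
Proof.
have -> : Phi mu 0 = 1.
  apply: (monic_orthogonal_unique infmu (Phi_monic_orthogonal 0)).
  by case: (szego_pair0 mu).
rewrite -lee_fin -N2_sqnorm; last exact: bounded_measurable_poly.
apply: N2_bounded; first exact: cmeasurable_polyfun.
by move=> z; rewrite /polyfun hornerC /sqn /=; lra.
Qed.

Variables (eps : R) (l : nat).
Hypotheses (eps01 : 0 < eps < 1) (marmu : Mar_class eps l mu).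

(** The infimum bounds the maximum over each window from below. Were all entries of a window below
    [eps], the maximum would be too, its default value 0 being below [eps] as well. *)
Lemma large_verblunsky n :
  exists2 j, (n <= j < (n + l).+1)%N & eps <= cabs (verblunsky mu j).
Proof.
have /andP[e0 _] := eps01; have [_ einf] := marmu.
apply: contrapT => noj.
have : \big[Num.max/0]_(n <= j < (n + l).+1) cabs (verblunsky mu j) < eps.
  rewrite big_nat; elim/big_ind: _ => // [x y xe ye|j nj].
    by rewrite gt_max xe ye.
  by rewrite ltNge; apply/negP => ej; apply: noj; exists j.
apply/negP; rewrite -leNgt; apply: le_trans einf _.
apply: ge_inf; last by exists n.
exists 0 => _ [m _ <-]; elim/big_ind: _ => // [x y x0 _|j _].
  by rewrite le_max x0.
exact: cabs_ge0.
Qed.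

(** Among any l + 1 consecutive indices one has |alpha_j| >= eps and contributes a factor at most 1
    - eps^2; the others do not increase the norm. *)
Lemma sqnorm_Phi_decay n :
  sqnorm mu (polyfun (Phi mu n)) <= (1 - eps ^+ 2) ^+ (n %/ l.+1).
Proof.
have /andP[e0 e1] := eps01.
have r0 : 0 <= 1 - eps ^+ 2 by rewrite subr_ge0 expr_le1 // ltW.
have step m : sqnorm mu (polyfun (Phi mu (m + l.+1))) <=
    (1 - eps ^+ 2) * sqnorm mu (polyfun (Phi mu m)).
  have [j /andP[mj jm] ej] := large_verblunsky m.
  apply: le_trans (sqnorm_Phi_anti (_ : j.+1 <= _)%N) _; first by rewrite addnS.
  rewrite sqnorm_Phi_step; apply: le_trans (_ : (1 - eps ^+ 2) * sqnorm mu (polyfun (Phi mu j)) <= _).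
    rewrite ler_wpM2r ?sqnorm_ge0 // lerD2l lerN2 sqn_cabs lerXn2r ?nnegrE ?cabs_ge0 //.
    exact: ltW.
  by rewrite ler_wpM2l // sqnorm_Phi_anti.
apply: le_trans (sqnorm_Phi_anti (leq_trunc_div n l.+1)) _.
elim: (n %/ l.+1)%N => [|m IH]; first by rewrite mul0n expr0 sqnorm_Phi0.
by rewrite mulSn addnC exprS; apply: le_trans (step _) _; rewrite ler_wpM2l.
Qed.

End markoff_decay.

(** * Truncated inversion of the reversed polynomial *)

Section elimination.
Context {R : realType}.

Lemma bin_le_exp n i : ('C(n, i) <= n ^ i)%N.
Proof.
elim: i n => [|i IH] n; first by rewrite bin0.
case: n => [|n]; first by rewrite bin0n.
apply: leq_trans (_ : i.+1 * 'C(n.+1, i.+1) <= _)%N; first by rewrite leq_pmull.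
rewrite -mul_bin_diag expnS leq_mul2l /= (leq_trans (IH n)) //.
by case: (i) => // j; rewrite leq_exp2r.
Qed.

(* [P] is the Taylor polynomial of [1 / B]: its coefficients are controlled
   without any information on the zeros of [B]. *)
Lemma taylor_inverse (n : nat) (B : {poly R[i]}) (K : nat) :
  (0 < n)%N -> (size B <= n.+1)%N -> B`_0 = 1 ->
  (forall i, cabs B`_i <= 'C(n, i)%:R) ->
  exists P Q : {poly R[i]}, [/\ P * B = 1 + Q * 'X^K, (size Q <= n)%N,
    forall i, cabs Q`_i <= (2 * n%:R) ^+ K * n%:R ^+ i &
    forall z : circleB R, cabs P.[pt z] <= (2 * n%:R) ^+ K].
Proof.
move=> n0 sB B0 B_le; have n1 : 1 <= n%:R :> R by rewrite ler1n.
have {}B_le i : cabs B`_i <= n%:R ^+ i.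
  by apply: le_trans (B_le i) _; rewrite -natrX ler_nat bin_le_exp.
elim: K => [|K [P [Q [PB sQ Q_le P_le]]]].
  exists 0, (-1); split=> [||i|z].
  - by rewrite mul0r expr0 mulr1 subrr.
  - by rewrite size_polyN size_poly1.
  - rewrite coefN coef1 cabsN expr0 mul1r; case: i => [|i].
      by rewrite cabs1.
    by rewrite cabs0 exprn_ge0.
  - by rewrite horner0 cabs0 expr0 ler01.
(* As B has constant term 1, Q - Q_0 B is divisible by z. Its degree is at most n, so the quotient
   again has degree below n: the remainder never outgrows a block of length n. *)
have sQB : (size (Q - (Q`_0)%:P * B)%R <= n.+1)%N.
  apply: leq_trans (size_polyD _ _) _; rewrite geq_max (leq_trans sQ) //= size_polyN.
  by rewrite mul_polyC (leq_trans (size_scale_leq _ _)).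
have [Q' sQ' EQ] := poly_shift sQB.
rewrite coefB coefCM B0 mulr1 subrr addr0 in EQ.
have c_le : cabs Q`_0 <= (2 * n%:R) ^+ K by have := Q_le 0%N; rewrite expr0 mulr1.
have p0 : 0 <= (2 * n%:R) ^+ K :> R by rewrite exprn_ge0 // mulr_ge0.
exists (P - (Q`_0)%:P * 'X^K), Q'; split=> // [|i|z].
- rewrite mulrBl PB exprS mulrA -EQ; ring.
- have -> : Q'`_i = Q`_i.+1 - Q`_0 * B`_i.+1.
    by have /(congr1 (fun p : {poly R[i]} => p`_i.+1)) := EQ; rewrite coefMX coefB coefCM.
  apply: le_trans (cabsD_le _ _) _; rewrite cabsN cabsM.
  (* Origin of the base 2 n: each elimination step adds two terms of the same size (factor 2) and
     shifts the index by one (factor n). *)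
  have -> : (2 * n%:R) ^+ K.+1 * n%:R ^+ i =
    (2 * n%:R) ^+ K * n%:R ^+ i.+1 + (2 * n%:R) ^+ K * n%:R ^+ i.+1 :> R.
    by rewrite !exprS; ring.
  by rewrite lerD // ler_pM // cabs_ge0.
- rewrite hornerD hornerN hornerCM hornerXn.
  apply: le_trans (cabsD_le _ _) _; rewrite cabsN cabsM.
  have -> : cabs (pt z ^+ K) = 1 by rewrite -sqrt_sqn sqnX sqn_pt expr1n sqrtr1.
  rewrite mulr1; apply: le_trans (lerD (P_le z) c_le) _.
  by rewrite exprS; nra.
Qed.

(** A normal form for the span: the list in [Espan] may repeat exponents, and the coefficients of
    one polynomial collect them. *)
Lemma EspanP (L : set nat) (f : circleB R -> R[i]) : Espan L f <->
  exists p : {poly R[i]}, (forall j, p`_j != 0 -> L j) /\ f = polyfun p.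
Proof.
split=> [[s [c [sL ->]]]|[p [pL ->]]].
  exists (\sum_(j <- s) (c j)%:P * 'X^j); split=> [j|].
    rewrite coef_sum => /eqP h; apply: contrapT => nLj; apply: h.
    rewrite big_seq big1 // => i si; rewrite coefCM coefXn.
    by case: eqP => [ij|_]; [case: nLj; rewrite ij; exact: sL|rewrite mulr0].
  apply/funext => z; rewrite /polyfun horner_sum; apply: eq_bigr => j _.
  by rewrite hornerCM hornerXn.
exists [seq j <- iota 0 (size p) | p`_j != 0], (fun j => p`_j); split.
  by move=> j; rewrite mem_filter => /andP[/pL].
apply/funext => z; rewrite /polyfun horner_coef big_filter.
rewrite -(big_mkord xpredT (fun i => p`_i * pt z ^+ i)) /index_iota subn0.
rewrite [RHS]big_mkcond; apply: eq_bigr => i _.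
by case: eqP => //= ->; rewrite mul0r.
Qed.

Lemma Espan0 (L : set nat) : Espan L (fun _ : circleB R => 0).
Proof.
apply/EspanP; exists 0; split=> [j|]; first by rewrite coef0 eqxx.
by apply/funext => z; rewrite /polyfun horner0.
Qed.

Lemma EspanD (L : set nat) (f g : circleB R -> R[i]) :
  Espan L f -> Espan L g -> Espan L (fun z => f z + g z).
Proof.
move=> /EspanP[p [pL ->]] /EspanP[q [qL ->]]; apply/EspanP; exists (p + q); split.
  move=> j; rewrite coefD; have [->|/pL //] := eqVneq p`_j 0.
  by rewrite add0r => /qL.
by apply/funext => z; rewrite /polyfun hornerD.
Qed.

Lemma EspanZ (L : set nat) (c : R[i]) (f : circleB R -> R[i]) :
  Espan L f -> Espan L (fun z => c * f z).
Proof.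
move=> /EspanP[p [pL ->]]; apply/EspanP; exists (c%:P * p); split.
  by move=> j; rewrite coefCM mulf_eq0 negb_or => /andP[_ /pL].
by apply/funext => z; rewrite /polyfun hornerCM.
Qed.

Lemma Espan_cmeasurable (L : set nat) : @Espan R L `<=` cmeasurable.
Proof. by move=> f /EspanP[p [_ ->]]; exact: cmeasurable_polyfun. Qed.

(* [L] contains intervals [k, k + n) whose length [n] beats [k log n]. *)
Definition has_long_gapless_blocks (L : set nat) : Prop :=
  forall (rho e : R) (d a : nat), 0 < rho < 1 -> (0 < d)%N -> 0 < e ->
  exists k n, [/\ (a <= k)%N, (0 < n)%N, forall j, (k <= j < k + n)%N -> L j &
    (2 * n%:R) ^+ (2 * (k + a)) * rho ^+ (n %/ d) < e].

Section dense.
Variables (L : set nat) (mu : probability (circleB R) R) (l : nat) (eps : R).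
Hypotheses (Lblocks : has_long_gapless_blocks L) (eps01 : 0 < eps < 1).
Hypothesis marmu : Mar_class eps l mu.

(* On the circle [conj z ^ a z ^ i + z ^ k Q(z)] is
   [conj z ^ a z ^ i (1 + z ^ K Q(z))] with [K = k + a - i]. *)
Lemma approximable_monomial a i :
  approximable mu (Espan L) (fun z => conjc (pt z) ^+ a * pt z ^+ i).
Proof.
have infmu := marmu.1; have /andP[eps0 eps1] := eps01.
have trig : trigpoly (fun z : circleB R => conjc (pt z) ^+ a * pt z ^+ i).
  by exists a, 'X^i; apply/funext => z; rewrite hornerXn.
split=> [|e e0]; first exact: cmeasurable_trigpoly.
have rho01 : 0 < 1 - eps ^+ 2 < 1.
  by rewrite subr_gt0 expr_lt1 ?(ltW eps0) // eps1 ltrBlDr ltrDl exprn_gt0.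
(* Asking for a block beyond a + i ensures i <= k, so the natural-number subtraction in k + a - i is
   genuine, and twice this order stays below the exponent 2 (k + (a + i)) of the hypothesis. *)
have [k [n [ak n0 kL small]]] := @Lblocks _ e l.+1 (a + i)%N rho01 (ltn0Sn l) e0.
have n1 : 1 <= n%:R :> R by rewrite ler1n.
have [B AB] := szego_pair_Phi infmu n.
have [_ sB B0 _ coef_le] := AB.
have [P [Q [PB sQ _ P_le]]] :=
  taylor_inverse (k + a - i) n0 sB B0 (fun j => (coef_le j).2).
exists (polyfun (- (Q * 'X^k))).
  apply/EspanP; exists (- (Q * 'X^k)); split=> // j.
  rewrite coefN oppr_eq0 coefMXn; case: ltnP => [_|kj]; first by rewrite eqxx.
  move=> Qj; apply: kL; rewrite kj /= -ltn_subLR // (leq_trans _ sQ) //.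
  by rewrite ltnNge; apply: contra Qj => sj; rewrite nth_default.
have -> : (fun z => conjc (pt z) ^+ a * pt z ^+ i - polyfun (- (Q * 'X^k)) z) =
    (fun z => conjc (pt z) ^+ a * pt z ^+ i * (P * B).[pt z]).
  apply/funext => z; rewrite PB /polyfun hornerN opprK hornerD !hornerM !hornerXn hornerC.
  rewrite mulrDr mulr1; congr (_ + _).
  have -> (x y u v : R[i]) : x * y * (u * v) = u * (x * (y * v)) by ring.
  rewrite -exprD; have -> : (i + (k + a - i) = a + k)%N by lia.
  by rewrite exprD (mulrA (conjc _ ^+ a)) ptJ_mul mul1r.
have mB := cmeasurable_polyfun B.
apply: (@le_lt_trans _ _
  (N2 mu (fun z => Complex ((2 * n%:R) ^+ (k + a - i)) 0 * polyfun B z))).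
  apply: le_N2.
  - apply: cmeasurableM; first exact: cmeasurable_trigpoly.
    exact: cmeasurable_polyfun.
  - exact: cmeasurableZ.
  - move=> z; rewrite hornerM !sqnM !sqnX sqnJ sqn_pt !expr1n !mul1r.
    by rewrite ler_wpM2r ?sqn_ge0 // sqn_real sqn_cabs lerXn2r ?nnegrE ?cabs_ge0.
rewrite N2Z // N2_sqnorm; last exact: bounded_measurable_poly.
rewrite (sqnorm_reversed AB) sqn_real -EFinM lte_fin; apply: le_lt_trans small.
apply: ler_pM; rewrite ?sqr_ge0 ?sqnorm_ge0 //; last exact: (sqnorm_Phi_decay infmu eps01 marmu).
by rewrite -exprM ler_weXn2l //; [nra|lia].
Qed.

Lemma approximable_trigpoly (f : circleB R -> R[i]) :
  trigpoly f -> approximable mu (Espan L) f.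
Proof.
move=> [a [p ->]].
have -> : (fun z : circleB R => conjc (pt z) ^+ a * p.[pt z]) =
    (fun z => \sum_(j < size p) p`_j * (conjc (pt z) ^+ a * pt z ^+ j)).
  apply/funext => z; rewrite horner_coef mulr_sumr; apply: eq_bigr => j _; ring.
apply: (approximable_sum (@Espan0 L) (@Espan_cmeasurable L) (@EspanD L)) => j.
apply: (approximableZ (@Espan_cmeasurable L) (@EspanZ L)).
exact: approximable_monomial.
Qed.

End dense.

Lemma Espan_dense (L : set nat) (mu : probability (circleB R) R) :
  has_long_gapless_blocks L -> Markoff mu -> L2dense mu (Espan L).
Proof.
move=> Lblocks [l [eps [eps01 marmu]]].
split=> [f /EspanP[p [_ ->]]|f L2f e e0].
  have [mp [C pC]] := bounded_measurable_poly p.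
  exact: L2_bounded pC.
have [mf appf] := approximable_L2 (@Espan0 L) (@Espan_cmeasurable L) (@EspanD L)
  (@EspanZ L) (approximable_trigpoly Lblocks eps01 marmu) L2f.
have [g Eg fg] := appf _ (exprn_gt0 2 e0).
by exists g => //; rewrite L2norm_lt.
Qed.

End elimination.

(** * Blocks of power length *)

Section power_blocks.
Context {R : realType}.

(* With [delta = (s - 1) / 2] and [x = k^delta], the logarithm of the left-hand
   side is at most [C k x - c k x^2 + O(1)], where [c > 0]. *)
Lemma power_block_decay (s rho e : R) (d a : nat) :
  1 < s -> 0 < rho < 1 -> (0 < d)%N -> 0 < e ->
  exists k0 : nat, forall k n : nat, (k0 <= k)%N ->
    k%:R `^ s <= n%:R <= 2 * k%:R `^ s ->
    (2 * n%:R) ^+ (2 * (k + a)) * rho ^+ (n %/ d) < e.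
Proof.
move=> s1 /andP[rho0 rho1] d0 e0.
pose delta := (s - 1) / 2; have delta0 : 0 < delta by rewrite divr_gt0 // subr_gt0.
pose c := - ln rho; have c0 : 0 < c by rewrite oppr_gt0 ln_lt0 // rho0.
(* A product of two bounds: 2 (k + a) <= 2 (1 + a) k and ln (2 n) <= (4 + s / delta) x. *)
pose C := 2 * (1 + a%:R) * (4 + s / delta).
(* For x >= T the quadratic term c k x^2 / d is at least (C + 1) k x. *)
pose T := (C + 1) * d%:R / c.
have d0' : 0 < d%:R :> R by rewrite ltr0n.
have a0 : 0 <= a%:R :> R by [].
have sd0 : 0 < s / delta by rewrite divr_gt0 // (lt_trans ltr01).
have C0 : 0 < C by rewrite /C !mulr_gt0 //; lra.
have T0 : 0 < T by rewrite /T divr_gt0 // mulr_gt0 //; lra.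
(* Three demands on k: x >= T, k > c - ln e, and k >= 1. The final exponent is at most c - k x <= c
   - k < ln e. *)
exists (Num.truncn (T `^ delta^-1 + `|c - ln e| + 1)).+1 => k n k0k /andP[kn nk].
pose K : R := k%:R; rewrite -/K in kn nk.
have K_gt : T `^ delta^-1 + `|c - ln e| + 1 < K.
  by apply: lt_le_trans (truncnS_gt _) _; rewrite ler_nat.
have Tp0 : 0 <= T `^ delta^-1 by exact: powR_ge0.
have ce := ler_norm (c - ln e); have ce0 := normr_ge0 (c - ln e).
have K1 : 1 <= K by lra.
have K0 : 0 < K by lra.
have KT : T `^ delta^-1 <= K by lra.
have Kce : c - ln e < K by lra.
pose x := K `^ delta.
have x0 : 0 < x by exact: powR_gt0.
have Tx : T <= x.
  have -> : T = (T `^ delta^-1) `^ delta.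
    by rewrite -powRrM mulVf ?gt_eqF // powRr1 // ltW.
  by apply: ge0_ler_powR; rewrite ?nnegrE // ltW.
have x1 : 1 <= x by rewrite -(powRr0 K) ler_powR // ltW.
have Ks : K `^ s = K * (x * x).
  have -> : s = 1 + (delta + delta) by rewrite /delta; field.
  rewrite !powRD ?powRr1 ?(ltW K0) //; apply/implyP => _; exact: lt0r_neq0.
have lnK : ln K <= x / delta.
  by rewrite ler_pdivlMr // mulrC -ln_powR ltW // ln_sublinear.
have Ks0 : 0 < K `^ s by exact: powR_gt0.
have n0 : 0 < n%:R :> R by exact: lt_le_trans kn.
have ln2n : ln (2 * n%:R) <= (4 + s / delta) * x.
  apply: le_trans (_ : ln (4 * K `^ s) <= _).
    by rewrite ler_ln ?posrE ?mulr_gt0 //; lra.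
  rewrite lnM ?posrE // ln_powR.
  have ln4 : ln 4 < 4 :> R by exact: ln_sublinear.
  have : s * ln K <= s / delta * x.
    by rewrite -mulrA (mulrC _ x) ler_wpM2l // ltW // (lt_trans ltr01).
  nra.
rewrite -ltr_ln ?posrE ?mulr_gt0 ?exprn_gt0 ?mulr_gt0 //.
rewrite lnM ?posrE ?exprn_gt0 ?mulr_gt0 // !lnXn ?mulr_gt0 //.
rewrite -[X in X + _]mulr_natl -[X in _ + X]mulr_natl.
have ka : (2 * (k + a))%:R <= 2 * (1 + a%:R) * K.
  by rewrite natrM natrD -/K; nra.
have first_le : (2 * (k + a))%:R * ln (2 * n%:R) <= C * K * x.
  apply: le_trans (_ : (2 * (k + a))%:R * ((4 + s / delta) * x) <= _).
    by rewrite ler_wpM2l.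
  have -> : C * K * x = 2 * (1 + a%:R) * K * ((4 + s / delta) * x) by rewrite /C; ring.
  by rewrite ler_wpM2r // mulr_ge0 ?(ltW x0) //; lra.
have q_ge : K * (x * x) / d%:R - 1 <= (n %/ d)%:R.
  rewrite lerBlDr ler_pdivrMr // -Ks (le_trans kn) //.
  by rewrite natr1 -natrM ler_nat ltnW // ltn_ceil.
have cx : (C + 1) * K * x <= c * (K * (x * x) / d%:R).
  have : C + 1 <= c * x / d%:R.
    by rewrite ler_pdivlMr // mulrC -(mulrC x) -ler_pdivrMr // mulrC.
  have -> : c * (K * (x * x) / d%:R) = (c * x / d%:R) * (K * x) by field; rewrite gt_eqF.
  by move=> h; rewrite -[leLHS]mulrA ler_wpM2r // mulr_ge0 // ltW.
(* The additive [c] pays for the rounding in the integer quotient. *)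
have second_le : (n %/ d)%:R * ln rho <= c - (C + 1) * K * x.
  have -> : ln rho = - c by rewrite opprK.
  nra.
nra.
Qed.

Lemma has_long_gapless_blocks_Lambda (s : R) (k : nat -> nat) :
  1 < s -> (forall j, (0 < k j)%N) ->
  (forall i j, (i < j)%N -> (k i < k j)%N) ->
  @has_long_gapless_blocks R (Lambda k (fun j => Num.truncn ((k j)%:R `^ s : R))).
Proof.
move=> s1 k_gt0 k_mono rho e d a rho01 d0 e0.
have [k0 hk0] := power_block_decay a s1 rho01 d0 e0.
have k_ge j : (j <= k j)%N.
  by elim: j => // j IH; apply: leq_ltn_trans IH (k_mono _ _ _).
(* A closed block contains one integer more than its length parameter. This successor gives n >=
   k^s, and n <= 2 k^s follows from k^s >= 1. *)
pose j := maxn a k0; pose n := (Num.truncn ((k j)%:R `^ s : R)).+1.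
have ks1 : 1 <= (k j)%:R `^ s :> R.
  by rewrite -[leLHS](powRr0 (k j)%:R) ler_powR ?ler1n // ltW // (lt_trans ltr01).
exists (k j), n; split=> //.
- by apply: leq_trans (k_ge j); rewrite leq_maxl.
- by move=> i /andP[ki ik]; exists j; rewrite ki /= -ltnS -addnS.
- apply: hk0; first by apply: leq_trans (k_ge j); rewrite leq_maxr.
  rewrite ltW ?truncnS_gt //= /n -natr1.
  have : (Num.truncn ((k j)%:R `^ s : R))%:R <= (k j)%:R `^ s :> R.
    by rewrite truncn_le // powR_ge0.
  lra.
Qed.

(** Writing m for the right end a + a^2 of block j, the next block starts at (j + 2) m + 2. Just
    before it, at most m of (j + 2) m + 1 integers belong to the set, a proportion below 1 / (j +
    1). *)
Fixpoint sparse_start (j : nat) : nat :=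
  if j is i.+1 then (i.+2 * (sparse_start i + sparse_start i ^ 2) + 2)%N else 1.

Lemma sparse_start_gt0 j : (0 < sparse_start j)%N.
Proof. by case: j => //= j; rewrite addnS. Qed.

Lemma sparse_start_ltS j : (sparse_start j < sparse_start j.+1)%N.
Proof. by rewrite /=; nia. Qed.

Lemma sparse_start_lt i j : (i < j)%N -> (sparse_start i < sparse_start j)%N.
Proof.
elim: j => // j IH; rewrite ltnS leq_eqVlt => /predU1P[->|/IH ij].
  exact: sparse_start_ltS.
exact: ltn_trans ij (sparse_start_ltS j).
Qed.

Definition sparse_set : set nat := Lambda sparse_start (fun j => sparse_start j ^ 2)%N.

(** Every integer up to the right end of block j is counted, and the gap after it contributes
    nothing. *)
Lemma sparse_set_count j N : N.+1 = sparse_start j.+1 ->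
  (\sum_(1 <= n < N.+1) (n \in sparse_set) <= sparse_start j + sparse_start j ^ 2)%N.
Proof.
move=> EN; pose m := (sparse_start j + sparse_start j ^ 2)%N.
have mN : (m.+1 <= N.+1)%N by rewrite EN /m /=; nia.
rewrite (@big_cat_nat _ _ _ m.+1) //= [X in (_ + X)%N]big_nat_cond [X in (_ + X)%N]big1 ?addn0.
  apply: (@leq_trans (\sum_(1 <= n < m.+1) 1)%N).
    by apply: leq_sum => n _; exact: leq_b1.
  by rewrite sum_nat_const_nat muln1 subn1.
move=> n /andP[/andP[mn nN] _]; apply/eqP; rewrite eqb0; apply/negP.
rewrite inE => -[i /andP[in_ ni]].
have [ij|ji] := leqP i j.
  have : (sparse_start i <= sparse_start j)%N.
    by move: ij; rewrite leq_eqVlt => /predU1P[->//|/sparse_start_lt/ltnW].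
  by move: ni mn; rewrite /m; nia.
have : (sparse_start j.+1 <= sparse_start i)%N.
  by move: ji; rewrite leq_eqVlt => /predU1P[->//|/sparse_start_lt/ltnW].
by move: nN in_; rewrite EN; lia.
Qed.

Lemma lower_density_sparse_set : lower_density R sparse_set = 0%E.
Proof.
rewrite /lower_density limn_einf_lim.
(* Arbitrarily late gaps make every tail infimum equal to 0, so the sequence of infima is
   constant. *)
set u := (X in einfs X); suff -> : einfs u = cst 0%E by exact: lim_cst.
apply/funext => n; apply/eqP; rewrite eq_le; apply/andP; split; last first.
  by apply: le_ereal_inf_tmp => _ [m _ <-]; rewrite /u lee_fin divr_ge0.
apply/lee_addgt0Pr => e e0; rewrite add0e.
have [j [nj je]] : exists j, (n <= j)%N /\ j.+1%:R^-1 <= e.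
  exists (maxn n (Num.truncn e^-1)); split; first by rewrite leq_maxl.
  rewrite invf_ple ?posrE // ltW // (lt_le_trans (truncnS_gt _)) // ler_nat ltnS.
  by rewrite leq_maxr.
pose N := (sparse_start j.+1).-1.
have EN : N.+1 = sparse_start j.+1 by rewrite prednK // sparse_start_gt0.
have j_le i : (i <= sparse_start i)%N.
  by elim: i => // i IH; apply: leq_ltn_trans IH (sparse_start_ltS i).
apply: ge_ereal_inf; exists (u N).
  exists N => //=; have := j_le j.+1; rewrite -EN; lia.
rewrite /u lee_fin; apply: le_trans je.
have N0 : (0 < N)%N by have := j_le j.+1; rewrite -EN /= /N /=; nia.
rewrite ler_pdivrMr ?ltr0n // ler_pdivlMl ?ltr0n // -natrM ler_nat.
apply: leq_trans (_ : j.+1 * (sparse_start j + sparse_start j ^ 2) <= _)%N.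
  by rewrite leq_mul2l sparse_set_count.
by rewrite -ltnS EN /=; nia.
Qed.

End power_blocks.

Theorem theorem1p2 (R : realType) :
  (forall (s : R) (k : nat -> nat),
     1 < s ->
     (forall j, (0 < k j)%N) ->
     (forall i j, (i < j)%N -> (k i < k j)%N) ->
     forall mu : probability (circleB R) R, Markoff mu ->
       L2dense mu (Espan (Lambda k (fun j => Num.truncn ((k j)%:R `^ s))))) /\
  (exists L : set nat,
     [/\ (forall n, L n -> (0 < n)%N),
         lower_density R L = 0%E &
         forall mu : probability (circleB R) R, Markoff mu ->
           L2dense mu (Espan L)]).
Proof.
split=> [s k s1 k_gt0 k_mono mu markoff_mu|].
  by apply: Espan_dense => //; exact: has_long_gapless_blocks_Lambda.
exists sparse_set; split; last first.
- move=> mu markoff_mu; apply: Espan_dense => //.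
  (* This is the case s = 2, where the power is an integer and the truncation is exact. *)
  have -> : sparse_set = Lambda sparse_start
      (fun j => Num.truncn ((sparse_start j)%:R `^ 2 : R)).
    congr Lambda; apply/funext => j.
    by rewrite powR_mulrn // -natrX natrK.
  apply: has_long_gapless_blocks_Lambda; first by rewrite ltr1n.
    exact: sparse_start_gt0.
  exact: sparse_start_lt.
- exact: lower_density_sparse_set.
- by move=> n [j /andP[+ _]]; apply: leq_trans; exact: sparse_start_gt0.
Qed.
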